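(* For each positive integer $n$ let $\sharp_n^\circ(\rho)$ be the number of zeros of the Stern polynomial $a(n;z)$ in the annulus $1-\rho \leq |z| \leq 1/(1-\rho)$, and let $\sharp_n^\angle(\theta_1,\theta_2)$ be the number of zeros of $a(n;z)$ in the sector $\theta_1 \leq \arg z < \theta_2$. For fixed real $\rho$, $\theta_1$, $\theta_2$ satisfying $0 < \rho < 1$ and $0 \leq \theta_1 < \theta_2 \leq 2\pi$, \[ -16 \sqrt{\frac{3 \log n - \log 8}{n}} < \frac{\sharp_n^\angle(\theta_1,\theta_2)}{\deg a(n;z)} - \frac{\theta_2-\theta_1}{2\pi} < 16 \sqrt{\frac{3 \log n - \log 8}{n}} \] and \[ 0 \leq 1 - \frac{\sharp_n^\circ(\rho)}{\deg a(n;z)} < \frac{2}{\rho} \cdot \frac{3\log n - \log 8}{n} \] for all integers $n > 0$ which are not powers of $2$ (where $1=2^0$ counts as a power of $2$).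
   Context: The Stern polynomials $\{a(n;z)\}_{n\ge 0}$ are defined recursively by $a(0;z)=0$, $a(1;z)=1$, and, for $n\geq 1$, $a(2n;z)=a(n;z^2)$ and $a(2n+1;z)=z\,a(n;z^2)+a(n+1;z^2)$. Zeros are complex zeros counted with multiplicity, $\arg z$ is taken in $[0,2\pi)$, and $\log$ is the natural logarithm. (For $n>0$ not a power of $2$, $a(n;z)$ is nonconstant, so $\deg a(n;z)>0$.) *)

(* Defs.v *)
From HB Require Import structures.
From mathcomp Require Import all_boot all_order all_algebra.
From mathcomp Require Import complex.
From mathcomp Require Import all_classical all_reals all_analysis.
From mathcomp Require Import zify.

Set Implicit Arguments.
Unset Strict Implicit.
Unset Printing Implicit Defensive.

Import Order.TTheory GRing.Theory Num.Theory.

Local Open Scope classical_set_scope.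
Local Open Scope ring_scope.

Section Stern.
Variable K : comNzRingType.

(* Structural recursion on the bound [k]; [n] steps suffice at [n]
   ([stern_rec_stern]). *)
Fixpoint stern_rec (k n : nat) : {poly K} :=
  if k is k'.+1 then
    if (n <= 1)%N then n%:R
    else if odd n then
      'X * (stern_rec k' n./2 \Po 'X^2) + (stern_rec k' n./2.+1 \Po 'X^2)
    else stern_rec k' n./2 \Po 'X^2
  else 0.

Definition stern (n : nat) : {poly K} := stern_rec n n.

Lemma stern_recS (k n : nat) : (1 < n)%N ->
  stern_rec k.+1 n =
    if odd n then
      'X * (stern_rec k n./2 \Po 'X^2) + (stern_rec k n./2.+1 \Po 'X^2)
    else stern_rec k n./2 \Po 'X^2.
Proof. by move=> n1; rewrite [LHS]/= leqNgt n1. Qed.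

Lemma stern_rec_stern (k n : nat) : (n <= k)%N -> stern_rec k n = stern n.
Proof.
suff H j : forall i m, (m <= i)%N -> (m <= j)%N -> stern_rec i m = stern_rec j m.
  by move=> nk; apply: H.
elim: j => [|j IH] [|i] m /= mi mj //.
- by rewrite (_ : m = 0)%N //; lia.
- by rewrite (_ : m = 0)%N //; lia.
- case: leqP => // m1; have := odd_double_half m.
  case: (odd m) => /= hm; last by rewrite IH //; lia.
  by rewrite (IH i m./2) ?(IH i m./2.+1) //; lia.
Qed.

Lemma stern0 : stern 0 = 0. Proof. by []. Qed.

Lemma stern1 : stern 1 = 1. Proof. by []. Qed.

Lemma stern_even (n : nat) : (0 < n)%N ->
  stern (2 * n) = stern n \Po 'X^2.
Proof.
move=> n0; rewrite mul2n -(@stern_rec_stern n.*2.+1 n.*2) // stern_recS; last by lia.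
by rewrite odd_double doubleK stern_rec_stern //; lia.
Qed.

Lemma stern_odd (n : nat) : (0 < n)%N ->
  stern (2 * n + 1) = 'X * (stern n \Po 'X^2) + (stern n.+1 \Po 'X^2).
Proof.
move=> n0; rewrite mul2n addn1 {1}/stern stern_recS; last by lia.
have -> : n.*2.+1./2 = n by lia.
by rewrite /= odd_double !stern_rec_stern //; lia.
Qed.

End Stern.

Section Complex.
Variable R : realType.

(* The argument of [z != 0], in [0, 2 * pi); the value at 0 is irrelevant. *)
Definition arg (z : R[i]) : R :=
  let t := acos (complex.Re z / Normc.normc z) in
  if 0 <= complex.Im z then t else 2 * pi - t.

(* Number of zeros of [p != 0] in [A], counted with multiplicity. *)
Definition num_zeros (p : {poly R[i]}) (A : set R[i]) : nat :=
  \sum_(z \in A) mup z p.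

Definition annulus (rho : R) : set R[i] :=
  [set z | (1 - rho)%:C%C <= `|z| <= (1 / (1 - rho))%:C%C].

Definition sector (theta1 theta2 : R) : set R[i] :=
  [set z | theta1 <= arg z < theta2].

Definition zeros_in_annulus (n : nat) (rho : R) : nat :=
  num_zeros (stern _ n) (annulus rho).

Definition zeros_in_sector (n : nat) (theta1 theta2 : R) : nat :=
  num_zeros (stern _ n) (sector theta1 theta2).

Definition stern_degree (n : nat) : nat := (size (stern R[i] n)).-1.

Lemma num_zerosE (c : R[i]) (s : seq R[i]) (A : set R[i]) : c != 0 ->
  num_zeros (c *: \prod_(z <- s) ('X - z%:P)) A = count (mem A) s.
Proof.
move=> c0; set p := _ *: _.
have mupE z : mup z p = count_mem z s.
  by rewrite /p -mul_polyC mupMr ?mu_prod_XsubC// rootC.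
have -> : num_zeros p A = \sum_(z <- undup s | z \in A) mup z p.
  rewrite (bigfs _ (undup_uniq s)) ?set_mem_set // => z _.
  by rewrite mem_undup mupE => zs; apply/count_memPn.
under eq_bigr do rewrite mupE.
rewrite -sum1_count -[RHS]big_undup_iterop_count.
by apply: eq_bigr => z _; rewrite -[LHS]natn.
Qed.

Lemma arg_spec (z : R[i]) : z != 0 ->
  [/\ 0 <= arg z, arg z < 2 * pi &
      z = (Normc.normc z * cos (arg z) +i* (Normc.normc z * sin (arg z)))%C].
Proof.
case: z => x y z0; rewrite /arg /=.
set r := Num.sqrt _.
have r0 : 0 < r.
  rewrite lt_def sqrtr_ge0 andbT; apply: contra z0 => /eqP e.
  by apply/eqP/Normc.eq0_normc.
have r2 : r ^+ 2 = x ^+ 2 + y ^+ 2 by rewrite sqr_sqrtr ?addr_ge0 ?sqr_ge0.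
have hx : (x / r) ^+ 2 = 1 - (y / r) ^+ 2.
  by apply/eqP; rewrite -subr_eq opprK !expr_div_n -mulrDl -r2 divff // expf_neq0 ?gt_eqF.
have c1 : -1 <= x / r <= 1.
  by rewrite -ler_norml -(ler_pXn2r (n := 2)) ?nnegrE // expr1n real_normK ?num_real //
     hx gerBl sqr_ge0.
have sa : sin (acos (x / r)) = `|y| / r.
  rewrite sin_acos // hx opprB addrC subrK sqrtr_sqr normrM normfV.
  by rewrite (gtr0_norm r0).
have ca : cos (acos (x / r)) = x / r by apply: acosK; rewrite in_itv.
have mK u : r * (u / r) = u by rewrite mulrC divfK ?gt_eqF.
have pi0 := @pi_gt0 R.
have a0 := acos_ge0 c1; have a1 := acos_lepi c1.
have [y0|y0] := leP 0 y.
  split => //; first by apply: le_lt_trans a1 _; rewrite ltr_pMl // ltr1n.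
  by rewrite ca sa !mK ger0_norm.
have a2 : 0 < acos (x / r).
  rewrite lt_def a0 andbT; apply: contraTneq y0 => e.
  move: sa; rewrite e sin0 => /esym/eqP; rewrite mulf_eq0 invr_eq0 (gt_eqF r0) orbF.
  by rewrite normr_eq0 => /eqP ->; rewrite ltxx.
split.
- by rewrite subr_ge0 (le_trans a1) // ler_pMl // ler1n.
- by rewrite gtrBl.
- rewrite mulr_natl addrC cosD2pi sinD2pi.
  by rewrite cosN sinN ca sa mulrN !mK ltr0_norm // opprK.
Qed.

End Complex.

(* Main.v *)
Require Import Defs.
From mathcomp Require Import all_boot all_order all_algebra cyclic separable cyclotomic.
From mathcomp Require Import complex.
From mathcomp Require Import all_classical all_reals all_analysis.
From mathcomp Require Import zify ring lra.
Set Implicit Arguments.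
Unset Strict Implicit.
Import Order.TTheory GRing.Theory Num.Theory.
Local Open Scope ring_scope.

(** Why the theorem is true.  Let [P] be the Stern polynomial of index [n], [N] its degree and
    [H] a bound for [|P|] on the unit circle.  By induction along the recursion [P] is monic
    with constant term 1 ([stern_shape]), [n <= 3 N] unless [n] is a power of 2
    ([stern_degree_lower]), and [H = n / 2] is admissible for [n >= 6] ([stern_circle_bound]).
    Hence [ln H / N <= X], where [X] is [3 ln (n / 2) / n = (3 ln n - ln 8) / n], and it
    suffices to bound the two discrepancies of a monic polynomial with [|P(0)| = 1] in terms of
    [ln H / N].  The indices 3 and 5 are treated apart.

    Annulus.  The Mahler measure of [P] is at most [H] ([mahler_measure_bound]), so [|ln |z||]
    summed over the zeros is at most [2 ln H], while every zero outside the annulus contributes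
    more than [rho].

    Sector.  This is an Erdos-Turan inequality.  Schur's comparison ([schur_radial]) moves the
    zeros radially to points [u_j] of the unit circle with [\prod_j |1 - w u_j| <= H] there,
    hence in the disc by the maximum principle.  So the function [ln H - \sum_j ln (1 - w u_j)]
    has nonnegative real part in the disc, and Caratheodory's inequality bounds the power sums of
    the [u_j] by [2 k ln H] ([power_sum_bound]), which bounds [\sum_j u_j / (1 - w u_j)]
    ([resolvent_sum_bound]).  Circle averages are taken over roots of unity, so that both the
    maximum principle and Caratheodory's inequality rest on the finite Fourier identity
    [dft_geometric] and no integral is needed.

    To count zeros in an arc, its indicator is written with two sawtooth functions
    ([indicator_sawtooth]).  The sawtooth is replaced by its convolution with the squared
    Poisson kernel of radius [r = 1 - d]; the error is at most [4 d^2 / |1 - r e^(i x)|^2], a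
    multiple of the Poisson kernel ([sawtooth_error_bound]).  The sums of the smooth sawtooth
    and of the error bound over the zeros are both expressed by the resolvent sum.  They
    amount to [O(ln H / d)] and [O(d N + ln H / d)], and [d = sqrt (ln H / N)] balances the two
    with a total constant below 16.  This needs [d <= 1 / 4]; if [X] is larger than [1 / 16]
    the sector bound exceeds 1 and holds for trivial reasons. *)

Local Notation Re := complex.Re.
Local Notation Im := complex.Im.
Local Notation cabs := Normc.normc.

(** * The real-valued absolute value on complex numbers *)

Section ComplexNorm.
Context {R : realType}.
Implicit Types (x y z w : R[i]) (t : R).

Lemma cabsE z : (cabs z)%:C%C = `|z|.
Proof. by []. Qed.

Lemma cabs_ge0 z : 0 <= cabs z.
Proof. by rewrite -lecR cabsE normr_ge0. Qed.

Lemma cabsM x y : cabs (x * y) = cabs x * cabs y.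
Proof. exact: Normc.normcM. Qed.

Lemma cabsX z n : cabs (z ^+ n) = cabs z ^+ n.
Proof.
by elim: n => [|n IH]; rewrite ?expr0 ?Normc.normc1 // !exprS cabsM IH.
Qed.

Lemma cabsV z : cabs z^-1 = (cabs z)^-1.
Proof. exact: Normc.normcV. Qed.

Lemma cabs_prod (I : Type) (s : seq I) (F : I -> R[i]) :
  cabs (\prod_(i <- s) F i) = \prod_(i <- s) cabs (F i).
Proof. exact: (big_morph _ cabsM (Normc.normc1 _)). Qed.

Lemma cabsD x y : cabs (x + y) <= cabs x + cabs y.
Proof. exact: le_normcD. Qed.

Lemma cabsN z : cabs (- z) = cabs z.
Proof. exact: normcN. Qed.

Lemma cabsB x y : cabs x - cabs y <= cabs (x - y).
Proof. by rewrite lerBlDr -{1}(subrK y x) cabsD. Qed.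

Lemma cabs_sum (I : Type) (s : seq I) (F : I -> R[i]) :
  cabs (\sum_(i <- s) F i) <= \sum_(i <- s) cabs (F i).
Proof.
elim: s => [|i s IH]; first by rewrite !big_nil Normc.normc0.
by rewrite !big_cons (le_trans (cabsD _ _)) // lerD2l.
Qed.

Lemma cabs_real t : cabs t%:C%C = `|t|.
Proof. by rewrite /Normc.normc /= expr0n /= addr0 sqrtr_sqr. Qed.

Lemma cabs_nat n : cabs (n%:R : R[i]) = n%:R.
Proof. by rewrite -(rmorph_nat (real_complex R)) cabs_real normr_nat. Qed.

Lemma cabs_eq0 z : (cabs z == 0) = (z == 0).
Proof.
apply/eqP/eqP => [|->]; [exact: Normc.eq0_normc | exact: Normc.normc0].
Qed.

Lemma sqr_cabs z : cabs z ^+ 2 = Re z ^+ 2 + Im z ^+ 2.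
Proof. by case: z => a b; rewrite /= sqr_sqrtr // addr_ge0 ?sqr_ge0. Qed.

Lemma cabs_conj z : cabs (z^*)%C = cabs z.
Proof. by case: z => a b; rewrite /= sqrrN. Qed.

Lemma mulz_conj z : z * (z^*)%C = (cabs z ^+ 2)%:C%C.
Proof. by rewrite rmorphXn /= cabsE sqr_normc. Qed.

Lemma norm_Re_le z : `|Re z| <= cabs z.
Proof. by rewrite -lecR cabsE normc_ge_Re. Qed.

Lemma Re_le_cabs z : Re z <= cabs z.
Proof. exact: le_trans (ler_norm _) (norm_Re_le z). Qed.

Lemma norm_Im_le z : `|Im z| <= cabs z.
Proof.
case: z => a b /=; rewrite -sqrtr_sqr ler_wsqrtr // lerDr; exact: sqr_ge0.
Qed.

Lemma ReD x y : Re (x + y) = Re x + Re y. Proof. by case: x y => ? ? []. Qed.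
Lemma ImD x y : Im (x + y) = Im x + Im y. Proof. by case: x y => ? ? []. Qed.
Lemma ReZ t z : Re (t%:C%C * z) = t * Re z.
Proof. by case: z => a b; rewrite /= mul0r subr0. Qed.
Lemma Re_sum (I : Type) (s : seq I) (F : I -> R[i]) :
  Re (\sum_(i <- s) F i) = \sum_(i <- s) Re (F i).
Proof. exact: (big_morph _ ReD). Qed.

Lemma Im_sum (I : Type) (s : seq I) (F : I -> R[i]) :
  Im (\sum_(i <- s) F i) = \sum_(i <- s) Im (F i).
Proof. exact: (big_morph _ ImD). Qed.

Lemma subr1_unit w : cabs w < 1 -> 1 - w != 0.
Proof.
apply: contraTneq => /eqP; rewrite subr_eq0 => /eqP <-.
by rewrite Normc.normc1 ltxx.
Qed.

Lemma cabs_exp_lt1 w n : (0 < n)%N -> cabs w < 1 -> cabs (w ^+ n) < 1.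
Proof. by move=> n0 w1; rewrite cabsX exprn_ilt1 ?cabs_ge0 // -lt0n. Qed.

Lemma cabs_unity_root n z : (0 < n)%N -> z ^+ n = 1 -> cabs z = 1.
Proof.
move=> n0 zn; apply/eqP; rewrite -(@pexpr_eq1 _ _ n) ?cabs_ge0 //.
by rewrite -cabsX zn Normc.normc1.
Qed.

End ComplexNorm.

(** * Removing geometric error terms and constant factors *)

Section GeometricLimits.
Context {R : realType}.

Lemma exprn_small (r e : R) : 0 <= r < 1 -> 0 < e -> exists n, r ^+ n < e.
Proof.
move=> /andP[r0 r1] e0.
have := @cvg_geometric R 1 r; rewrite ger0_norm // => /(_ r1).
move/cvgr0_norm_lt => /(_ e e0) [n _ /(_ n (leqnn n))] /=.
by rewrite mul1r ger0_norm ?exprn_ge0 // => h; exists n.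
Qed.

Lemma ler_of_geometric (x y c r : R) : 0 <= r < 1 -> 0 <= c ->
  (forall n, x <= y + c * r ^+ n) -> x <= y.
Proof.
move=> r01 c0 H; apply/ler_addgt0Pr => e e0.
have [n /ltW rn] := exprn_small r01 (divr_gt0 e0 (ltr_wpDl c0 ltr01)).
apply: le_trans (H n) _; rewrite lerD2l.
apply: le_trans (ler_wpM2l c0 rn) _.
rewrite mulrA ler_pdivrMr ?ltr_wpDl // [e * _]mulrC ler_wpM2r //; first exact: ltW.
by rewrite lerDl.
Qed.

(** Removes the constant factor from an estimate that holds for all powers of a polynomial. *)
Lemma ler_of_powers (x y c : R) : 0 <= x -> 0 <= y ->
  (forall n, x ^+ n <= c * y ^+ n) -> x <= y.
Proof.
move=> x0 y0 H; rewrite leNgt; apply/negP => yx.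
have xp : 0 < x by apply: le_lt_trans yx.
have c0 : 0 <= c by have := H 0%N; rewrite !expr0 mulr1; apply: le_trans.
have r01 : 0 <= y / x < 1.
  by rewrite divr_ge0 // ltr_pdivrMr // mul1r.
have : (1 : R) <= 0.
  apply: (ler_of_geometric r01 c0) => n; rewrite add0r.
  by rewrite expr_div_n mulrA ler_pdivlMr ?exprn_gt0 // mul1r.
by rewrite leNgt ltr01.
Qed.

End GeometricLimits.

(** * Averages over roots of unity and the maximum principle *)

Section RootsOfUnity.
Context {R : realType}.
Implicit Types (w z omega : R[i]).

Lemma exists_prim_root (n : nat) : (0 < n)%N ->
  exists omega : R[i], n.-primitive_root omega.
Proof.
pose p : {poly R[i]} := 'X^n - 1; have [r Dp] := closed_field_poly_normal p.
move=> n_gt0; rewrite (monicP _) ?monicXnsubC // scale1r in Dp.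
have rn1: all n.-unity_root r by apply/allP=> z; rewrite -root_prod_XsubC -Dp.
have sz_r: (n < (size r).+1)%N.
  by rewrite -(size_prod_XsubC r id) -Dp size_XnsubC.
have [|z] := hasP (has_prim_root n_gt0 rn1 _ sz_r); last by exists z.
by rewrite -separable_prod_XsubC -Dp separable_Xn_sub_1 // pnatr_eq0 -lt0n.
Qed.

Lemma sum_unity_root n omega : n.-primitive_root omega -> forall k,
  \sum_(m < n) (omega ^+ m) ^+ k = if (n %| k)%N then n%:R else 0.
Proof.
move=> po k; under eq_bigr do rewrite exprAC.
have := subrX1 (omega ^+ k) n.
rewrite -exprM mulnC exprM (prim_expr_order po) expr1n subrr => /esym/eqP.
rewrite mulf_eq0 subr_eq0 -(prim_order_dvd po) /dvdn.
case: ifP => [/eqP k0 _|_ /= /eqP //].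
rewrite (_ : omega ^+ k = 1).
  by under eq_bigr do rewrite expr1n; rewrite sumr_const card_ord.
by apply/eqP; rewrite -(prim_order_dvd po) /dvdn k0.
Qed.

(** The discrete Fourier coefficients of a geometric series: summing over the roots of unity
    keeps the exponents congruent to [a] and folds them into one more geometric series. *)
Lemma dft_geometric n omega w a : n.-primitive_root omega -> (a < n)%N -> cabs w < 1 ->
  \sum_(m < n) ((omega ^+ m)^-1) ^+ a / (1 - w * omega ^+ m) =
    n%:R * w ^+ a / (1 - w ^+ n).
Proof.
move=> po an w1; have n0 := prim_order_gt0 po.
have om m : (omega ^+ m) ^+ n = 1 by rewrite exprAC (prim_expr_order po) expr1n.
have om0 m : omega ^+ m != 0.
  apply/eqP => e; have /eqP := om m.
  by rewrite e expr0n -(prednK n0) /= eq_sym oner_eq0.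
have d0 m : 1 - w * omega ^+ m != 0.
  by rewrite subr1_unit // cabsM (cabs_unity_root n0 (om m)) mulr1.
have dn : 1 - w ^+ n != 0 by rewrite subr1_unit // cabs_exp_lt1.
apply: (mulIf dn); rewrite divfK // mulr_suml.
have E (m : 'I_n) : (omega ^+ m)^-1 ^+ a / (1 - w * omega ^+ m) * (1 - w ^+ n) =
    \sum_(b < n) w ^+ b * (omega ^+ m) ^+ (n - a + b).
  have -> : 1 - w ^+ n = (1 - w * omega ^+ m) * \sum_(b < n) (w * omega ^+ m) ^+ b.
    by apply: oppr_inj; rewrite -mulNr !opprB -subrX1 exprMn om mulr1.
  rewrite mulrA divfK // mulr_sumr; apply: eq_bigr => b _.
  rewrite exprMn exprD mulrCA; congr (_ * (_ * _)).
  apply: (mulIf (expf_neq0 a (om0 m))).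
  by rewrite -exprMn mulVf // expr1n -exprD subnK ?om // ltnW.
under eq_bigr do rewrite E.
rewrite exchange_big /=.
under eq_bigr => b _ do rewrite -mulr_sumr sum_unity_root //.
rewrite (bigD1 (Ordinal an)) //= subnK ?(ltnW an) // dvdnn big1 ?addr0 1?mulrC //.
move=> b ba; case: ifP => [|_]; last by rewrite mulr0.
move=> /dvdnP[[|[|q]] e].
- by have := ltn_ord b; lia.
- have ea : nat_of_ord b = a by have := ltn_ord b; lia.
  by case/eqP: ba; apply: val_inj.
- by have := ltn_ord b; nia.
Qed.

(** Maximum principle at interior points.  Interpolation at the roots of unity costs a
    constant factor depending on [w]; applying it to the powers of [p] removes the factor. *)
Lemma polynomial_max_principle (p : {poly R[i]}) (B : R) :
  (forall v, cabs v = 1 -> cabs p.[v] <= B) ->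
  forall w, cabs w < 1 -> cabs p.[w] <= B.
Proof.
move=> pB w w1.
have B0 : 0 <= B by apply: le_trans (pB 1 (Normc.normc1 _)); exact: cabs_ge0.
have w0 := cabs_ge0 w.
apply: (@ler_of_powers _ _ _ (2 / (1 - cabs w))) => // [|q]; first exact: cabs_ge0.
rewrite -cabsX -horner_exp; set P := p ^+ q; pose n := (size P).+1.
have [omega po] := @exists_prim_root n isT.
have om m : cabs (omega ^+ m) = 1.
  by rewrite (@cabs_unity_root _ n) // exprAC (prim_expr_order po) expr1n.
(* the evaluation of [P] at [w] as a kernel average of its values on the circle *)
have E : P.[w] * n%:R =
    (1 - w ^+ n) * \sum_(m < n) P.[(omega ^+ m)^-1] / (1 - w * omega ^+ m).
  have dn : 1 - w ^+ n != 0 by rewrite subr1_unit // cabs_exp_lt1.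
  under eq_bigr do rewrite horner_coef mulr_suml.
  rewrite exchange_big /=.
  under eq_bigr => i _.
    under eq_bigr do rewrite -mulrA.
    rewrite -mulr_sumr dft_geometric //; last by rewrite ltnS ltnW.
    over.
  rewrite horner_coef mulr_suml mulr_sumr; apply: eq_bigr => i _.
  by rewrite [RHS]mulrC !mulrA divfK // mulrAC.
have n0 : (0 : R) < n%:R by rewrite ltr0n.
rewrite -(ler_pM2r n0) -{1}(cabs_nat n) -cabsM E cabsM.
have B1 : cabs (1 - w ^+ n) <= 2.
  rewrite (le_trans (cabsD _ _)) // cabsN Normc.normc1 cabsX.
  by rewrite -[2]/(1 + 1) lerD2l exprn_ile1 // ltW.
have B2 : cabs (\sum_(m < n) P.[(omega ^+ m)^-1] / (1 - w * omega ^+ m)) <=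
    n%:R * (B ^+ q / (1 - cabs w)).
  rewrite (le_trans (cabs_sum _ _)) // -[X in X%:R * _](card_ord n) mulr_natl -sumr_const.
  apply: ler_sum => m _; rewrite cabsM cabsV; apply: ler_pM; rewrite ?invr_ge0 ?cabs_ge0 //.
    rewrite horner_exp cabsX lerXn2r ?nnegrE ?cabs_ge0 // pB // cabsV om invr1 //.
  rewrite lef_pV2 ?posrE ?subr_gt0 //; last first.
    by rewrite lt_neqAle cabs_ge0 andbT eq_sym cabs_eq0 subr1_unit // cabsM om mulr1.
  by apply: le_trans (cabsB _ _); rewrite Normc.normc1 cabsM om mulr1.
apply: le_trans (ler_pM (cabs_ge0 _) (cabs_ge0 _) B1 B2) _.
by rewrite le_eqVlt; apply/orP; left; apply/eqP; ring.
Qed.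

End RootsOfUnity.

(** * Derivatives of explicit real functions *)

Section Calculus.
Context {R : realType}.
Implicit Types (f g : R -> R) (x a b : R).

(** The predicate behind the class [is_derive], so that derivatives are found by the rules
    below and not by class search. *)
Definition deriv_at x f a : Prop := is_derive x 1 f a.

Lemma deriv_at_eq f x a b : deriv_at x f a -> a = b -> deriv_at x f b.
Proof. by move=> fa <-. Qed.

Lemma derive_add f g x a b : deriv_at x f a -> deriv_at x g b ->
  deriv_at x (fun t => f t + g t) (a + b).
Proof. exact: is_deriveD. Qed.

Lemma derive_opp f x a : deriv_at x f a -> deriv_at x (fun t => - f t) (- a).
Proof. exact: is_deriveN. Qed.

Lemma derive_mul f g x a b : deriv_at x f a -> deriv_at x g b ->
  deriv_at x (fun t => f t * g t) (f x * b + g x * a).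
Proof. exact: is_deriveM. Qed.

Lemma derive_cst (c x : R) : deriv_at x (fun=> c) 0.
Proof. exact: is_derive_cst. Qed.

Lemma derive_id x : deriv_at x (fun t : R => t) 1.
Proof. exact: is_derive_id. Qed.

Lemma derive_exp f n x a : deriv_at x f a ->
  deriv_at x (fun t => f t ^+ n) (n%:R * f x ^+ n.-1 * a).
Proof. by move=> df; rewrite -exprfctE; exact: is_deriveX. Qed.

Lemma derive_inv f x a : f x != 0 -> deriv_at x f a ->
  deriv_at x (fun t => (f t)^-1) (- a / f x ^+ 2).
Proof.
move=> f0 df; apply: is_derive_eq (is_deriveV f0 df) _.
by rewrite /GRing.scale /= mulNr mulrC mulNr.
Qed.

Lemma derive_ln f x a : 0 < f x -> deriv_at x f a ->
  deriv_at x (fun t => ln (f t)) (a / f x).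
Proof.
by move=> f0 df; rewrite mulrC; apply: is_derive1_comp df; exact: is_derive1_ln.
Qed.

Lemma derive_atan f x a : deriv_at x f a ->
  deriv_at x (fun t => atan (f t)) (a / (1 + f x ^+ 2)).
Proof.
by move=> df; rewrite mulrC; apply: is_derive1_comp df; exact: is_derive1_atan.
Qed.

Lemma derive_sum n (F : 'I_n -> R -> R) (dF : 'I_n -> R) x :
  (forall i, deriv_at x (F i) (dF i)) ->
  deriv_at x (fun t => \sum_(i < n) F i t) (\sum_(i < n) dF i).
Proof.
move=> dFi; have -> : (fun t => \sum_(i < n) F i t) = \sum_(i < n) F i.
  by apply/funext => t; rewrite fct_sumE.
exact: is_derive_sum.
Qed.

Lemma ler_of_derive f df a b : a <= b ->
  (forall x, a <= x <= b -> deriv_at x f (df x)) ->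
  (forall x, a <= x <= b -> 0 <= df x) -> f a <= f b.
Proof.
move=> ab fd df0.
have [||c cab e] := @MVT_segment R f df a b ab.
- by move=> x; rewrite in_itv /= => /andP[ax xb]; apply: fd; rewrite !ltW.
- apply: derivable_within_continuous => x; rewrite in_itv /= => xab.
  by case: (fd x xab).
- by rewrite -subr_ge0 e mulr_ge0 ?subr_ge0 // df0 // -in_itv.
Qed.

Lemma derive_sin x : deriv_at x (fun t : R => sin t) (cos x).
Proof. exact: is_derive_sin. Qed.

Lemma derive_cos x : deriv_at x (fun t : R => cos t) (- sin x).
Proof. exact: is_derive_cos. Qed.

End Calculus.

Ltac derive_explicit :=
  repeat lazymatch goal with
  | |- deriv_at _ (fun t => t) _ => refine (derive_id _)
  | |- deriv_at _ (fun _ => ?c) _ => refine (derive_cst _ _)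
  | |- deriv_at _ sin _ => refine (derive_sin _)
  | |- deriv_at _ cos _ => refine (derive_cos _)
  | |- deriv_at ?x (GRing.mul ?c) ?d => change (deriv_at x (fun t => c * t) d)
  | |- deriv_at ?x Algebra.opp ?d => change (deriv_at x (fun t => - t) d)
  | |- deriv_at ?x (Algebra.add ?c) ?d => change (deriv_at x (fun t => c + t) d)
  | |- deriv_at _ (fun t => _ + _) _ => refine (derive_add _ _)
  | |- deriv_at _ (fun t => - _) _ => refine (derive_opp _)
  | |- deriv_at _ (fun t => _ * _) _ => refine (derive_mul _ _)
  | |- deriv_at _ (fun t => _ ^+ _) _ => refine (derive_exp _ _)
  | |- deriv_at _ (fun t => _^-1) _ => refine (derive_inv _ _)
  | |- deriv_at _ (fun t => ln _) _ => refine (derive_ln _ _)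
  | |- deriv_at _ (fun t => atan _) _ => refine (derive_atan _)
  end.

Ltac derive_eq := refine (deriv_at_eq _ _).

(** * Bounds for the power sums of points on the circle *)

Section FourierWeights.
Context {R : realType}.
Implicit Types (y v w : R[i]) (s r : R).

Lemma derive_ln_cabs y s : cabs y <= 1 -> 0 <= s < 1 ->
  deriv_at s (fun t => ln (cabs (1 - t%:C%C * y))) (- Re (y / (1 - s%:C%C * y))).
Proof.
move=> y1 /andP[s0 s1].
have N0 : 1 - s%:C%C * y != 0.
  rewrite subr1_unit // cabsM cabs_real ger0_norm //.
  by apply: le_lt_trans s1; rewrite ler_piMr.
case: y y1 N0 => c d y1 N0.
pose u t := (1 - t * c) ^+ 2 + (t * d) ^+ 2.
have uE t : cabs (1 - t%:C%C * (c +i* d)%C) ^+ 2 = u t.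
  by rewrite sqr_cabs /u /=; ring.
have u0 : 0 < u s by rewrite -uE exprn_gt0 // lt_neqAle cabs_ge0 eq_sym cabs_eq0 N0.
have -> : (fun t => ln (cabs (1 - t%:C%C * (c +i* d)%C))) = (fun t => 2^-1 * ln (u t)).
  apply/funext => t; rewrite -uE.
  have [->|n0] := eqVneq (cabs (1 - t%:C%C * (c +i* d)%C)) 0.
    by rewrite expr0n /= ln0 // mulr0.
  rewrite lnXn; last by rewrite lt_neqAle cabs_ge0 eq_sym n0.
  by rewrite -[ln _ *+ 2]mulr_natl mulrA mulVf ?mul1r // pnatr_eq0.
derive_eq; first by rewrite /u; derive_explicit.
have u1 : u s != 0 by rewrite gt_eqF.
move: u1; rewrite /u /=; set U := (X in X != 0) => u1.
have -> : (1 - (s * c - 0 * d)) ^+ 2 + (0 - (s * d + 0 * c)) ^+ 2 = U by rewrite /U; ring.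
by rewrite /U in u1 *; field.
Qed.

Lemma Re_half y : (Re y)%:C%C = 2^-1%:C%C * y + 2^-1%:C%C * (y^*)%C.
Proof.
by case: y => a b; apply/eqP; rewrite eq_complex /=; apply/andP; split; apply/eqP; field.
Qed.

(** The weight [1 + Re (lam v^-(k+1))] extracts from the series of [v y / (1 - s v y)] the terms
    of order [k+1].  Over the [n]-th roots of unity with [n = k + L + 2] it also picks up
    aliased terms, all of order at least [L] in [s]. *)
Lemma weighted_dft_bound (k L : nat) (omega lam y : R[i]) s r :
  (k.+1 + L).+1.-primitive_root omega -> cabs lam = 1 -> cabs y = 1 ->
  0 <= s <= r -> r < 1 -> 
  cabs (\sum_(m < (k.+1 + L).+1)
          (1 + Re (lam * (omega ^+ m)^-1 ^+ k.+1))%:C%C *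
          (omega ^+ m * y / (1 - s%:C%C * (omega ^+ m * y)))
        - (k.+1 + L).+1%:R * (2^-1%:C%C * (lam * s%:C%C ^+ k * y ^+ k.+1))) <=
  (k.+1 + L).+1%:R * (2 * (r ^+ L / (1 - r))).
Proof.
set n := (k.+1 + L).+1 => po lam1 y1 /andP[s0 sr] r1.
have n0 : (0 < n)%N by [].
have om m : (omega ^+ m) ^+ n = 1 by rewrite exprAC (prim_expr_order po) expr1n.
have om1 m : cabs (omega ^+ m) = 1 by apply: cabs_unity_root (om m).
have om0 m : omega ^+ m != 0 by rewrite -cabs_eq0 om1 oner_neq0.
pose w := s%:C%C * y.
have wE : cabs w = s by rewrite cabsM cabs_real ger0_norm // y1 mulr1.
have w1 : cabs w < 1 by rewrite wE (le_lt_trans sr).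
pose W := (1 - w ^+ n)^-1.
have dn : 1 - w ^+ n != 0 by rewrite subr1_unit // cabs_exp_lt1.
have r0 : 0 <= r by apply: le_trans sr.
have r1' : 0 < 1 - r by rewrite subr_gt0.
have WE : cabs W <= (1 - r)^-1.
  rewrite /W cabsV lef_pV2 ?posrE //; last by rewrite lt_neqAle cabs_ge0 eq_sym cabs_eq0 dn.
  apply: le_trans (cabsB _ _); rewrite Normc.normc1 lerB // cabsX wE exprS.
  by rewrite (le_trans _ sr) // ler_piMr // exprn_ile1 // (le_trans sr) // ltW.
have small a : (L <= a)%N -> cabs (y * w ^+ a * W) <= r ^+ L / (1 - r).
  move=> La; rewrite !cabsM y1 mul1r cabsX wE; apply: ler_pM; rewrite ?exprn_ge0 ?cabs_ge0 //.
  rewrite (@le_trans _ _ (r ^+ a)) ?lerXn2r ?nnegrE //.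
  by rewrite ler_wiXn2l // ltW.
have E : \sum_(m < n) (1 + Re (lam * (omega ^+ m)^-1 ^+ k.+1))%:C%C *
      (omega ^+ m * y / (1 - s%:C%C * (omega ^+ m * y))) =
    n%:R * (y * w ^+ n.-1 * W + 2^-1%:C%C * (lam * (y * w ^+ k * W))
      + 2^-1%:C%C * ((lam^*)%C * (y * w ^+ L * W))).
  have Em (m : 'I_n) : (1 + Re (lam * (omega ^+ m)^-1 ^+ k.+1))%:C%C *
      (omega ^+ m * y / (1 - s%:C%C * (omega ^+ m * y))) =
    y * ((omega ^+ m)^-1 ^+ n.-1 / (1 - w * omega ^+ m)) +
    2^-1%:C%C * (lam * (y * ((omega ^+ m)^-1 ^+ k / (1 - w * omega ^+ m)))) +
    2^-1%:C%C * ((lam^*)%C * (y * ((omega ^+ m)^-1 ^+ L / (1 - w * omega ^+ m)))).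
    set v := omega ^+ m.
    have vJ : (v^*)%C = v^-1.
      by apply: (mulfI (om0 m)); rewrite mulz_conj om1 expr1n divff.
    have vV : v^-1 ^+ n.-1 = v.
      by apply: (mulIf (expf_neq0 n.-1 (om0 m))); rewrite -exprMn (mulVf (om0 m)) expr1n -exprS om.
    have vL : v^-1 ^+ L = v * v ^+ k.+1.
      apply: (mulIf (expf_neq0 L (om0 m))); rewrite -exprMn (mulVf (om0 m)) expr1n.
      by rewrite -exprS -exprD -(om m).
    have vK : v^-1 ^+ k = v * v^-1 ^+ k.+1 by rewrite exprS mulrA (divff (om0 m)) mul1r.
    have cJ : ((lam * v^-1 ^+ k.+1)^*)%C = (lam^*)%C * v ^+ k.+1.
      by rewrite rmorphM rmorphXn fmorphV /= vJ invrK.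
    rewrite rmorphD /= Re_half cJ vV vL vK rmorph1.
    have -> : s%:C%C * (v * y) = w * v by rewrite /w; ring.
    move: (v^-1 ^+ k.+1) (v ^+ k.+1) (1 - w * v)^-1 => A B D.
    by ring.
  rewrite (eq_bigr _ (fun m _ => Em m)) !big_split /= -!mulr_sumr.
  rewrite !dft_geometric //; try lia.
  by rewrite /W; ring.
rewrite E -mulrBr cabsM cabs_nat ler_wpM2l //.
have -> : y * w ^+ n.-1 * W + 2^-1%:C%C * (lam * (y * w ^+ k * W)) +
    2^-1%:C%C * ((lam^*)%C * (y * w ^+ L * W)) - 2^-1%:C%C * (lam * s%:C%C ^+ k * y ^+ k.+1) =
    y * w ^+ n.-1 * W + (2^-1%:C%C * (lam * (y * w ^+ (k + n) * W)) +
    2^-1%:C%C * ((lam^*)%C * (y * w ^+ L * W))).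
  have -> : lam * s%:C%C ^+ k * y ^+ k.+1 = lam * (y * w ^+ k * W) * (1 - w ^+ n).
    by rewrite /W !mulrA divfK // exprMn exprS; ring.
  by rewrite exprD; ring.
have h0 : cabs (2^-1%:C%C : R[i]) = 2^-1 by rewrite cabs_real ger0_norm.
apply: le_trans (cabsD _ _) _.
have S1 := @small n.-1 (leq_addl _ _).
have S2 : cabs (2^-1%:C%C * (lam * (y * w ^+ (k + n) * W))) <= 2^-1 * (r ^+ L / (1 - r)).
  rewrite [cabs _]cabsM h0 [cabs (lam * _)]cabsM lam1 mul1r ler_wpM2l //.
  by apply: small; rewrite /n; lia.
have S3 : cabs (2^-1%:C%C * ((lam^*)%C * (y * w ^+ L * W))) <= 2^-1 * (r ^+ L / (1 - r)).
  by rewrite [cabs _]cabsM h0 [cabs (_ * _)]cabsM cabs_conj lam1 mul1r ler_wpM2l // small.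
have := cabsD (2^-1%:C%C * (lam * (y * w ^+ (k + n) * W)))
  (2^-1%:C%C * ((lam^*)%C * (y * w ^+ L * W))).
move: S1 S2 S3; set q := r ^+ L / (1 - r); lra.
Qed.

End FourierWeights.

Section PowerSums.
Context {R : realType}.
Implicit Types (w : R[i]) (r : R).

Lemma bernoulli_le (e : R) k : 0 <= e <= 1 -> 1 - k%:R * e <= (1 - e) ^+ k.
Proof.
move=> /andP[e0 e1]; elim: k => [|k IH]; first by rewrite mul0r subr0 expr0.
have q0 : 0 <= k%:R * e ^+ 2 by rewrite mulr_ge0 ?sqr_ge0.
rewrite exprS; apply: (@le_trans _ _ ((1 - e) * (1 - k%:R * e))).
  by rewrite -natr1; move: q0; lra.
by rewrite ler_wpM2l // subr_ge0.
Qed.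

Variables (N : nat) (z : 'I_N -> R[i]) (h : R).
Hypothesis z1 : forall j, cabs (z j) = 1.
Hypothesis zh : forall w, cabs w < 1 -> \sum_(j < N) ln (cabs (1 - w * z j)) <= h.

(** Write [K = k + 1].  The function [h - \sum_j ln |1 - r v z_j|] of [v] on the circle is
    nonnegative with mean [h], and the sum in question, times [r^K / (2 K)], is its [K]-th
    Fourier coefficient.  Testing it against the nonnegative weight [1 + Re (lam v^-K)] gives the
    bound.  The average runs over [n]-th roots of unity with [n] tending to infinity, and the
    logarithms are handled through their derivative in the radius. *)
Lemma power_sum_Re_bound (k : nat) (lam : R[i]) r : cabs lam = 1 -> 0 <= r < 1 ->
  - Re (lam * \sum_(j < N) z j ^+ k.+1) * r ^+ k.+1 <= 2 * k.+1%:R * h.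
Proof.
move=> lam1 /andP[r0 r1]; set S := \sum_(j < N) _.
have r1' : 0 < 1 - r by rewrite subr_gt0.
have kp : 0 < k.+1%:R :> R by rewrite ltr0n.
suff H : - Re (lam * S) * r ^+ k.+1 / (2 * k.+1%:R) <= h.
  by move: H; rewrite ler_pdivrMr ?mulr_gt0 // mulrC [h * _]mulrC.
apply: (@ler_of_geometric _ _ _ (N%:R * (2 / (1 - r))) r); first by rewrite r0.
  by rewrite mulr_ge0 // divr_ge0 // ltW.
move=> L; pose n := (k.+1 + L).+1; have [omega po] := @exists_prim_root R n isT.
have np : 0 < n%:R :> R by rewrite ltr0n.
have om1 m : cabs (omega ^+ m) = 1.
  by apply: (@cabs_unity_root _ n) => //; rewrite exprAC (prim_expr_order po) expr1n.
pose p (m : nat) := 1 + Re (lam * (omega ^+ m)^-1 ^+ k.+1).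
have p0 m : 0 <= p m.
  have := norm_Re_le (lam * (omega ^+ m)^-1 ^+ k.+1).
  rewrite cabsM lam1 mul1r cabsX cabsV om1 invr1 expr1n ler_norml => /andP[].
  by rewrite -lerBlDl sub0r.
have sum_p : \sum_(m < n) p m = n%:R.
  rewrite big_split /= sumr_const card_ord -Re_sum -mulr_sumr.
  (* the weight has mean 1 since [n] does not divide the exponent [n - k - 1] *)
  have -> : \sum_(m < n) (omega ^+ m)^-1 ^+ k.+1 = \sum_(m < n) (omega ^+ m) ^+ L.+1.
    apply: eq_bigr => m _; have o0 : omega ^+ m != 0 by rewrite -cabs_eq0 om1 oner_neq0.
    apply: (mulIf (expf_neq0 k.+1 o0)); rewrite -exprMn (mulVf o0) expr1n -exprD addSn.
    by rewrite [(L + _)%N]addnC exprAC (prim_expr_order po) expr1n.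
  rewrite sum_unity_root //; case: ifP => [/dvdn_leq|_].
    by move=> /(_ isT); rewrite /n; lia.
  by rewrite mulr0 addr0.
pose W s := \sum_(m < n) p m * \sum_(j < N) ln (cabs (1 - s%:C%C * (omega ^+ m * z j))).
pose dW s := \sum_(m < n) p m *
  \sum_(j < N) - Re (omega ^+ m * z j / (1 - s%:C%C * (omega ^+ m * z j))).
have W0 : W 0 = 0.
  rewrite /W big1 // => m _; rewrite big1 ?mulr0 // => j _.
  by rewrite mul0r subr0 Normc.normc1 ln1.
have Wr : W r <= n%:R * h.
  rewrite -sum_p mulr_suml; apply: ler_sum => m _; rewrite ler_wpM2l //.
  have -> : \sum_(j < N) ln (cabs (1 - r%:C%C * (omega ^+ m * z j))) =
            \sum_(j < N) ln (cabs (1 - r%:C%C * omega ^+ m * z j)).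
    by apply: eq_bigr => j _; rewrite mulrA.
  by apply: zh; rewrite cabsM om1 mulr1 cabs_real ger0_norm.
have dWE s : dW s = - Re (\sum_(j < N) \sum_(m < n) (p m)%:C%C *
    (omega ^+ m * z j / (1 - s%:C%C * (omega ^+ m * z j)))).
  rewrite exchange_big /= Re_sum /dW -sumrN; apply: eq_bigr => m _.
  by rewrite Re_sum -sumrN mulr_sumr; apply: eq_bigr => j _; rewrite ReZ mulrN.
pose c := Re (lam * S) / 2.
pose e := N%:R * (2 * (r ^+ L / (1 - r))).
pose g s := W s + n%:R * (c / k.+1%:R * s ^+ k.+1 + e * s).
have : g 0 <= g r.
  apply: (@ler_of_derive _ g (fun s => dW s + n%:R * (c * s ^+ k + e))) => //.
  - move=> s /andP[s0 sr]; have s1 : s < 1 by apply: le_lt_trans r1.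
    apply: derive_add.
      apply: derive_sum => m; derive_eq.
        refine (derive_mul (derive_cst _ _) (derive_sum _)) => j.
        by apply: derive_ln_cabs; rewrite ?s0 // cabsM om1 z1 mulr1.
      by rewrite /= mulr0 addr0.
    derive_eq; first by derive_explicit.
    rewrite /=. by field; rewrite nat1r pnatr_eq0.
  - move=> s /andP[s0 sr].
    have : cabs (\sum_(j < N) (\sum_(m < n) (p m)%:C%C *
        (omega ^+ m * z j / (1 - s%:C%C * (omega ^+ m * z j))) -
        n%:R * (2^-1%:C%C * (lam * s%:C%C ^+ k * z j ^+ k.+1)))) <= n%:R * e.
      apply: le_trans (cabs_sum _ _) _.
      have -> : n%:R * e = \sum_(j < N) n%:R * (2 * (r ^+ L / (1 - r))).
        by rewrite sumr_const card_ord /e -[RHS]mulr_natl mulrCA.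
      by apply: ler_sum => j _; apply: weighted_dft_bound; rewrite ?s0.
    rewrite sumrB => /(le_trans (Re_le_cabs _)).
    rewrite dWE; set X := \sum_(j < N) \sum_(m < n) _.
    have -> : \sum_(j < N) n%:R * (2^-1%:C%C * (lam * s%:C%C ^+ k * z j ^+ k.+1)) =
        (n%:R * (2^-1 * s ^+ k))%:C%C * (lam * S).
      rewrite -!mulr_sumr !rmorphM rmorphXn rmorph_nat /= /S.
      by ring.
    rewrite ReD.
    have -> : Re (- ((n%:R * (2^-1 * s ^+ k))%:C%C * (lam * S))) = - (n%:R * c * s ^+ k).
      by rewrite -mulrN ReZ /c; case: (lam * S) => a b /=; field.
    by move=> H; rewrite mulrDr mulrA; move: H; clearbody c e X; lra.
rewrite /g W0 expr0n /= !mulr0 !addr0 mulr0 => /le_trans/(_ (lerD Wr (lexx _))).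
rewrite addr0 -mulrDr pmulr_rge0 // => H.
have er : e * r <= N%:R * (2 / (1 - r)) * r ^+ L.
  rewrite (_ : _ * r ^+ L = e); last by rewrite /e; ring.
  have e0 : 0 <= e by rewrite /e !mulr_ge0 ?exprn_ge0 // invr_ge0 ltW.
  by rewrite ler_piMr // ltW.
rewrite (_ : - Re _ * _ / _ = - (c / k.+1%:R * r ^+ k.+1)); last first.
  by rewrite /c; field; rewrite nat1r pnatr_eq0.
move: H er; set a := _ * r ^+ k.+1; set b := _ * r ^+ L; clearbody a b; lra.
Qed.

(** Caratheodory's coefficient inequality for [h - \sum_j ln (1 - w z_j)], whose real part is
    nonnegative in the disc and equals [h] at the origin. *)
Lemma power_sum_bound (k : nat) :
  cabs (\sum_(j < N) z j ^+ k.+1) <= 2 * k.+1%:R * h.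
Proof.
set S := \sum_(j < N) _.
have key (r : R) : 0 <= r < 1 -> cabs S * r ^+ k.+1 <= 2 * k.+1%:R * h.
  have [S0|S0] := eqVneq (cabs S) 0.
    move=> r01; have := power_sum_Re_bound k (Normc.normc1 R) r01.
    have /eqP := S0; rewrite cabs_eq0 -/S => /eqP ->.
    by rewrite Normc.normc0 mulr0 /= oppr0 !mul0r.
  pose lam := - ((cabs S)^-1%:C%C * (S^*)%C).
  have lam1 : cabs lam = 1.
    by rewrite cabsN cabsM cabs_conj cabs_real ger0_norm ?invr_ge0 ?cabs_ge0 // mulVf.
  move=> r01; have := power_sum_Re_bound k lam1 r01.
  rewrite -/S; have -> : lam * S = (- cabs S)%:C%C.
    rewrite /lam mulNr -mulrA [_ * S]mulrC mulz_conj -rmorphM /= expr2 mulrA mulVf //.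
    by rewrite mul1r rmorphN.
  by rewrite /= opprK.
apply: (@ler_of_geometric _ _ _ (cabs S * k.+1%:R) 2^-1).
- by rewrite invr_ge0 ler0n invf_lt1 // ltr1n.
- by rewrite mulr_ge0 ?cabs_ge0.
move=> n; set e := 2^-1 ^+ n.
have e01 : 0 <= e <= 1 by rewrite exprn_ge0 //= exprn_ile1 // invf_le1 // ler1n.
have /andP[e0 e1] := e01.
have r01 : 0 <= 1 - e < 1 by rewrite subr_ge0 e1 gtrBl exprn_gt0.
have := key _ r01; have := ler_wpM2l (cabs_ge0 S) (bernoulli_le k.+1 e01).
lra.
Qed.

Lemma sum_geometric_weighted (r : R) K : 0 <= r < 1 ->
  \sum_(k < K) k.+1%:R * r ^+ k <= (1 - r)^-2.
Proof.
move=> /andP[r0 r1]; have r1' : 0 < 1 - r by rewrite subr_gt0.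
have E : (\sum_(k < K) k.+1%:R * r ^+ k) * (1 - r) ^+ 2 = 1 - r ^+ K * (1 + K%:R * (1 - r)).
  elim: K => [|K IH]; first by rewrite big_ord0 expr0; ring.
  by rewrite big_ord_recr /= mulrDl IH [r ^+ K.+1]exprS -[K.+1%:R]nat1r; ring.
rewrite -[_^-1]mul1r ler_pdivlMr ?exprn_gt0 // E gerBl.
by rewrite mulr_ge0 ?exprn_ge0 // addr_ge0 // mulr_ge0 // ltW.
Qed.

(** The sum is minus the logarithmic derivative of [\prod_j (1 - w z_j)].  Its power series has
    the power sums as coefficients, so their linear growth in [k] yields a double pole at the
    circle.  All smoothed counting functions below are controlled by this estimate alone. *)
Lemma resolvent_sum_bound (w : R[i]) : cabs w < 1 ->
  cabs (\sum_(j < N) z j / (1 - w * z j)) <= 2 * h / (1 - cabs w) ^+ 2.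
Proof.
move=> w1; have w0 := cabs_ge0 w; set r := cabs w in w0 w1 *.
have r1 : 0 < 1 - r by rewrite subr_gt0.
have h0 : 0 <= h.
  have := zh (w := 0); rewrite Normc.normc0 ltr01 => /(_ isT).
  by rewrite big1 // => j _; rewrite mul0r subr0 Normc.normc1 ln1.
have d0 j : 1 - w * z j != 0 by rewrite subr1_unit // cabsM z1 mulr1.
apply: (@ler_of_geometric _ _ _ (N%:R / (1 - r)) r); first by rewrite w0.
  by rewrite divr_ge0 // ltW.
move=> K.
have -> : \sum_(j < N) z j / (1 - w * z j) =
    \sum_(k < K) w ^+ k * (\sum_(j < N) z j ^+ k.+1) +
    \sum_(j < N) w ^+ K * z j ^+ K.+1 / (1 - w * z j).
  under [X in _ = X + _]eq_bigr do rewrite mulr_sumr.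
  rewrite exchange_big -big_split /=; apply: eq_bigr => j _.
  apply: (mulIf (d0 j)); rewrite mulrDl !divfK //.
  have -> : \sum_(k < K) w ^+ k * z j ^+ k.+1 = z j * \sum_(k < K) (w * z j) ^+ k.
    by rewrite mulr_sumr; apply: eq_bigr => k _; rewrite exprMn exprS mulrCA.
  rewrite -mulrA [_ * (1 - _)]mulrC -[1 - w * z j]opprB mulNr -subrX1 exprMn exprS.
  by ring.
apply: le_trans (cabsD _ _) _; apply: lerD; apply: le_trans (cabs_sum _ _) _.
  apply: (@le_trans _ _ (\sum_(k < K) 2 * h * (k.+1%:R * r ^+ k))).
    apply: ler_sum => k _; rewrite cabsM cabsX -/r mulrA [_ * r ^+ k]mulrC.
    by rewrite ler_wpM2l ?exprn_ge0 // (le_trans (power_sum_bound k)) // mulrAC.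
  rewrite -mulr_sumr ler_wpM2l ?mulr_ge0 //.
  by apply: sum_geometric_weighted; rewrite w0.
have -> : N%:R / (1 - r) * r ^+ K = \sum_(j < N) r ^+ K / (1 - r).
  by rewrite sumr_const card_ord -[RHS]mulr_natl; ring.
apply: ler_sum => j _; rewrite !cabsM !cabsX z1 expr1n mulr1 -/r cabsV.
rewrite ler_wpM2l ?exprn_ge0 // lef_pV2 ?posrE //; last first.
  by rewrite lt_neqAle cabs_ge0 eq_sym cabs_eq0 d0.
by apply: le_trans (cabsB _ _); rewrite Normc.normc1 cabsM z1 mulr1.
Qed.

End PowerSums.

(** * A smooth approximation of the sawtooth function *)

Section Sawtooth.
Context {R : realType}.
Implicit Types (r s t x d : R).

Lemma sin_le_id x : 0 <= x -> sin x <= x.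
Proof.
move=> x0; have : 0 - sin 0 <= x - sin x.
  apply: (@ler_of_derive _ (fun t => t - sin t) (fun t => 1 - cos t)) => [//|t _|t _].
    by derive_explicit.
  by rewrite subr_ge0 cos_le1.
by rewrite sin0; lra.
Qed.

Lemma cos_ge_quadratic x : 0 <= x -> 1 - x ^+ 2 / 2 <= cos x.
Proof.
move=> x0; have : cos 0 + 0 ^+ 2 / 2 <= cos x + x ^+ 2 / 2.
  apply: (@ler_of_derive _ (fun t => cos t + t ^+ 2 / 2) (fun t => - sin t + t)) => [//|t _|].
    by derive_eq; [derive_explicit | rewrite /=; field].
  by move=> t /andP[t0 _]; have := sin_le_id t0; lra.
by rewrite cos0; lra.
Qed.

Lemma sin_ge_half d : 0 <= d <= 1 -> d / 2 <= sin d.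
Proof.
move=> /andP[d0 d1]; have : sin 0 - 0 / 2 <= sin d - d / 2.
  apply: (@ler_of_derive _ (fun t => sin t - t / 2) (fun t => cos t - 2^-1)) => [//|t _|].
    by derive_eq; [derive_explicit | rewrite /=; field].
  move=> t /andP[t0 td]; have := cos_ge_quadratic t0.
  have : t ^+ 2 <= 1 by rewrite exprn_ile1 // (le_trans td).
  by lra.
by rewrite sin0; lra.
Qed.

Lemma sin_nondecreasing_pihalf d x : 0 <= d -> d <= x <= pi / 2 -> sin d <= sin x.
Proof.
move=> d0 /andP[dx xp]; apply: (@ler_of_derive _ (fun t => sin t) (fun t => cos t)) => [//|t _|].
  exact: derive_sin.
move=> t /andP[dt tx]; apply: cos_ge0_pihalf; rewrite (le_trans tx xp) andbT.
by apply: le_trans (le_trans d0 dt); rewrite oppr_le0 divr_ge0 // pi_ge0.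
Qed.

(** [|1 - r e^(i x)|^2] *)
Definition circle_dist2 r x := 1 - 2 * r * cos x + r ^+ 2.

(** The conjugate Poisson kernel integrated in the radius, plus a multiple of that kernel.
    It is the convolution of the sawtooth [(pi - x) / 2] with the square of the Poisson kernel,
    normalised to mean 1; the square decays fast enough for the error to be summable. *)
Definition smooth_sawtooth r x :=
  atan (r * sin x / (1 - r * cos x)) +
  (1 - r ^+ 2) / (1 + r ^+ 2) * (r * sin x / circle_dist2 r x).

Lemma circle_dist2_gt0 r x : 0 <= r < 1 -> 0 < circle_dist2 r x.
Proof.
move=> /andP[r0 r1]; have : 0 <= r * (1 - cos x) by rewrite mulr_ge0 ?subr_ge0 ?cos_le1.
have : 0 < (1 - r) ^+ 2 by rewrite exprn_gt0 // subr_gt0.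
by rewrite /circle_dist2; lra.
Qed.

Lemma subr1_cos_gt0 r x : 0 <= r < 1 -> 0 < 1 - r * cos x.
Proof.
move=> /andP[r0 r1]; have : 0 <= r * (1 - cos x) by rewrite mulr_ge0 ?subr_ge0 ?cos_le1.
by lra.
Qed.

Lemma circle_dist2E r x : circle_dist2 r x = (1 - r * cos x) ^+ 2 + (r * sin x) ^+ 2.
Proof. by rewrite exprMn sin2cos2 /circle_dist2; ring. Qed.

Lemma derive_circle_dist2 r x :
  deriv_at x (circle_dist2 r) (2 * r * sin x).
Proof. by rewrite /circle_dist2; derive_eq; [derive_explicit | rewrite /=; ring]. Qed.

(** Minus half the normalised square of the Poisson kernel: of constant sign, and decaying like
    the fourth power of the distance to the jump, hence faster than the majorant's derivative. *)
Lemma derive_sawtooth_error r x : 0 <= r < 1 ->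
  deriv_at x (fun t => (pi - t) / 2 - smooth_sawtooth r t)
    (- ((1 - r ^+ 2) ^+ 3 / (2 * (1 + r ^+ 2)) / circle_dist2 r x ^+ 2)).
Proof.
move=> r01; have D0 := circle_dist2_gt0 x r01; have C0 := subr1_cos_gt0 x r01.
have datan : deriv_at x (fun t => atan (r * sin t / (1 - r * cos t)))
    ((r * cos x - r ^+ 2) / circle_dist2 r x).
  derive_eq; first by derive_explicit; rewrite gt_eqF.
  rewrite /=; have := circle_dist2E r x; move: D0 C0 (cos2Dsin2 x).
  move: (circle_dist2 r x) (cos x) (sin x) => D c s D0 C0 cs DE.
  have -> : 1 + (r * s / (1 - r * c)) ^+ 2 = D / (1 - r * c) ^+ 2.
    by rewrite DE; field; rewrite gt_eqF.
  have -> : r * c - r ^+ 2 = r * c * (1 - r * c) - (r * s) ^+ 2.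
    by rewrite (_ : (r * s) ^+ 2 = r ^+ 2 * (1 - c ^+ 2)); [ring | rewrite -cs; ring].
  by field; rewrite !gt_eqF.
have dkernel : deriv_at x (fun t => r * sin t / circle_dist2 r t)
    ((r * cos x * (1 + r ^+ 2) - 2 * r ^+ 2) / circle_dist2 r x ^+ 2).
  derive_eq.
    refine (derive_mul _ (derive_inv _ (derive_circle_dist2 r x))).
      by derive_explicit.
    by rewrite gt_eqF.
  rewrite /=; have -> : r * cos x * (1 + r ^+ 2) - 2 * r ^+ 2 =
      r * cos x * circle_dist2 r x - 2 * r ^+ 2 * sin x ^+ 2.
    by rewrite sin2cos2 /circle_dist2; ring.
  by field; rewrite gt_eqF.
derive_eq.
  refine (derive_add _ (derive_opp (derive_add datan
    (derive_mul (derive_cst _ _) dkernel)))).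
  by derive_explicit.
rewrite /= /circle_dist2.
move: D0; rewrite /circle_dist2; set D := (X in 0 < X) => D0.
have r2 : 0 < 1 + r ^+ 2 by rewrite ltr_pwDl // sqr_ge0.
rewrite /D in D0 *. by field; rewrite !gt_eqF.
Qed.

Lemma smooth_sawtooth_reflect r x : smooth_sawtooth r (2 * pi - x) = - smooth_sawtooth r x.
Proof.
have e : 2 * pi - x = - x + pi *+ 2 by ring.
rewrite /smooth_sawtooth /circle_dist2 e cosD2pi sinD2pi cosN sinN.
by rewrite mulrN !mulNr atanN mulrN opprD.
Qed.

Lemma sawtooth_error_decreasing r x t : 0 <= r < 1 -> x <= t ->
  (pi - t) / 2 - smooth_sawtooth r t <= (pi - x) / 2 - smooth_sawtooth r x.
Proof.
move=> r01 xt; rewrite -lerN2.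
apply: (@ler_of_derive _ (fun t => - ((pi - t) / 2 - smooth_sawtooth r t)) _ _ _ xt).
  by move=> y _; apply: derive_opp; exact: derive_sawtooth_error.
move=> y _; rewrite /= opprK; have /andP[r0 r1] := r01.
apply: divr_ge0; [apply: divr_ge0|].
- by rewrite exprn_ge0 // subr_ge0 exprn_ile1 // ltW.
- by rewrite mulr_ge0 // addr_ge0 // sqr_ge0.
- by rewrite exprn_ge0 // ltW // circle_dist2_gt0.
Qed.

Lemma sawtooth_error_at_pi r : (pi - pi) / 2 - smooth_sawtooth r pi = 0.
Proof. by rewrite /smooth_sawtooth sinpi mulr0 !mul0r atan0 mulr0 subrr mul0r addr0 subr0. Qed.

Lemma kernel_constant_le r : 0 <= r < 1 ->
  (1 - r ^+ 2) ^+ 3 / (2 * (1 + r ^+ 2)) <= 2 * (1 - r) ^+ 3.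
Proof.
move=> /andP[r0 r1]; have r2 : 0 < 1 + r ^+ 2 by rewrite ltr_pwDl // sqr_ge0.
rewrite ler_pdivrMr ?mulr_gt0 //.
have -> : (1 - r ^+ 2) ^+ 3 = (1 - r) ^+ 3 * (1 + r) ^+ 3 by ring.
have d3 : 0 <= (1 - r) ^+ 3 by rewrite exprn_ge0 // subr_ge0 ltW.
have H : (1 + r) ^+ 3 <= 4 * (1 + r ^+ 2).
  have : 0 <= (1 - r) * (r ^+ 2 + 3) by rewrite mulr_ge0 ?subr_ge0 ?addr_ge0 ?sqr_ge0 ?ltW.
  by lra.
apply: le_trans (ler_wpM2l d3 H) _.
by rewrite le_eqVlt; apply/orP; left; apply/eqP; ring.
Qed.

(** Near [pi] the bound decreases too slowly to be compared through derivatives, but there the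
    error is of smaller order, being at most the length of the interval times the derivative. *)
Lemma sawtooth_error_far r x : 3 / 4 <= r < 1 -> pi / 2 <= x <= pi ->
  (pi - x) / 2 - smooth_sawtooth r x <= 4 * (1 - r) ^+ 2 / circle_dist2 r x.
Proof.
move=> /andP[r34 r1] /andP[px xp]; have r0 : 0 <= r by lra.
have r01 : 0 <= r < 1 by rewrite r0.
set d := 1 - r; have d0 : 0 < d by rewrite subr_gt0.
have d3 : 0 <= 2 * d ^+ 3 by rewrite mulr_ge0 ?exprn_ge0 // ltW.
have dist_ge1 t : pi / 2 <= t <= pi -> 1 <= circle_dist2 r t.
  move=> /andP[pt tp].
  have : 0 <= r * - cos t.
    rewrite mulr_ge0 // -(cosN t) -cosDpi cos_ge0_pihalf //; apply/andP; split; lra.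
  by have := sqr_ge0 r; rewrite /circle_dist2; lra.
have : 2 * d ^+ 3 * x + ((pi - x) / 2 - smooth_sawtooth r x) <=
       2 * d ^+ 3 * pi + ((pi - pi) / 2 - smooth_sawtooth r pi).
  pose K := (1 - r ^+ 2) ^+ 3 / (2 * (1 + r ^+ 2)).
  apply: (@ler_of_derive _ (fun t => 2 * d ^+ 3 * t + ((pi - t) / 2 - smooth_sawtooth r t))
    (fun t => 2 * d ^+ 3 - K / circle_dist2 r t ^+ 2)) => [//|t _|t /andP[xt tp]].
    apply: derive_add; last exact: derive_sawtooth_error.
    by derive_eq; [derive_explicit | rewrite /=; ring].
  have t1 : 1 <= circle_dist2 r t by rewrite dist_ge1 // tp (le_trans px).
  rewrite subr_ge0 ler_pdivrMr ?exprn_gt0 ?circle_dist2_gt0 //.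
  apply: le_trans (kernel_constant_le r01) _.
  by rewrite -/d ler_peMr // exprn_ege1.
rewrite sawtooth_error_at_pi addr0 => H.
have E3 : (pi - x) / 2 - smooth_sawtooth r x <= 4 * d ^+ 3.
  have : 2 * d ^+ 3 * (pi - x) <= 2 * d ^+ 3 * 2.
    rewrite ler_wpM2l //; have := pihalf_lt2 R; lra.
  by move: H; lra.
apply: le_trans E3 _; rewrite ler_pdivlMr ?circle_dist2_gt0 //.
have D4 : circle_dist2 r x <= 4.
  have : 0 <= r * (1 + cos x) by rewrite mulr_ge0 // -lerBlDl sub0r cos_geN1.
  have : 0 <= (1 - r) * (3 + r) by rewrite mulr_ge0 // ?ltW //; lra.
  by rewrite /circle_dist2; lra.
have dD : d * circle_dist2 r x <= 1.
  have : d * circle_dist2 r x <= d * 4 by rewrite ler_wpM2l // ltW.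
  by rewrite {2}/d; lra.
have d2 : 0 <= 4 * d ^+ 2 by rewrite mulr_ge0 ?sqr_ge0.
have := ler_wpM2l d2 dD; rewrite mulr1 => /(le_trans _); apply.
by rewrite le_eqVlt; apply/orP; left; apply/eqP; ring.
Qed.

(** The derivative of the bound and that of the error have the same denominator
    [circle_dist2 r x ^+ 2], so in the middle range they are compared through their numerators. *)
Lemma sawtooth_error_upper r x : 3 / 4 <= r < 1 -> 0 <= x <= pi ->
  (pi - x) / 2 - smooth_sawtooth r x <= 4 * (1 - r) ^+ 2 / circle_dist2 r x.
Proof.
move=> r34 /andP[x0 xp]; have /andP[r3 r1] := r34; have r0 : 0 <= r by lra.
have r01 : 0 <= r < 1 by rewrite r0.
have [px|xp2] := leP (pi / 2) x; first by apply: sawtooth_error_far; rewrite ?px.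
set d := 1 - r; have d0 : 0 < d by rewrite subr_gt0.
have d1 : d <= 1 / 4 by rewrite /d; lra.
have p1 := pihalf_ge1 R.
have [xd|dx] := leP x d.
  (* at distance at most [d] from the jump the bound exceeds the whole jump *)
  have := sawtooth_error_decreasing r01 x0.
  rewrite {2}/smooth_sawtooth sin0 mulr0 !mul0r atan0 mulr0 addr0 !subr0 => /le_trans; apply.
  apply: (@le_trans _ _ 2); first exact/ltW/pihalf_lt2.
  rewrite ler_pdivlMr ?circle_dist2_gt0 //.
  have x2 : x ^+ 2 <= d ^+ 2 by rewrite lerXn2r ?nnegrE // ltW.
  have : r * (1 - cos x) <= 1 * (x ^+ 2 / 2).
    have c1 : 0 <= 1 - cos x by rewrite subr_ge0 cos_le1.
    have c2 : 1 - cos x <= x ^+ 2 / 2 by have := cos_ge_quadratic x0; lra.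
    by apply: ler_pM (ltW r1) c2.
  move: x2; rewrite /circle_dist2 /d; lra.
pose K := (1 - r ^+ 2) ^+ 3 / (2 * (1 + r ^+ 2)).
have far : (pi - pi / 2) / 2 - smooth_sawtooth r (pi / 2) <=
    4 * d ^+ 2 / circle_dist2 r (pi / 2) by apply: sawtooth_error_far => //; lra.
have : 4 * d ^+ 2 * - (circle_dist2 r x)^-1 + ((pi - x) / 2 - smooth_sawtooth r x) <=
  4 * d ^+ 2 * - (circle_dist2 r (pi / 2))^-1 + ((pi - pi / 2) / 2 - smooth_sawtooth r (pi / 2)).
  apply: (@ler_of_derive _ (fun t => 4 * d ^+ 2 * - (circle_dist2 r t)^-1 +
      ((pi - t) / 2 - smooth_sawtooth r t))
    (fun t => (4 * d ^+ 2 * (2 * r * sin t) - K) / circle_dist2 r t ^+ 2)).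
  - exact: ltW.
  - move=> t _; have D0 := circle_dist2_gt0 t r01.
    derive_eq.
      refine (derive_add (derive_mul (derive_cst _ _)
        (derive_opp (derive_inv _ (derive_circle_dist2 r t)))) (derive_sawtooth_error t r01)).
      by rewrite gt_eqF.
    by rewrite -/K /=; field; rewrite gt_eqF.
  move=> t /andP[xt tp]; apply: divr_ge0; last by rewrite exprn_ge0 // ltW // circle_dist2_gt0.
  rewrite subr_ge0 (le_trans (kernel_constant_le r01)) // -/d.
  have s2 : d / 2 <= sin t.
    apply: le_trans (@sin_ge_half d _) _; first by rewrite ltW //=; lra.
    by apply: sin_nondecreasing_pihalf; rewrite ?tp ?(ltW d0) // andbT ltW // (lt_le_trans dx).
  have : 3 / 4 * (d / 2) <= r * sin t by apply: ler_pM => //; lra.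
  move=> rs; have : d ^+ 2 * (3 / 4 * (d / 2)) <= d ^+ 2 * (r * sin t).
    by rewrite ler_wpM2l // exprn_ge0 // ltW.
  have : 0 <= d ^+ 3 by rewrite exprn_ge0 // ltW.
  by lra.
by rewrite !mulrN; move: far; lra.
Qed.

(** The two-sided bound, which makes one kernel serve as majorant and minorant at once. *)
Lemma sawtooth_error_bound r x : 3 / 4 <= r < 1 -> 0 <= x <= 2 * pi ->
  `|(pi - x) / 2 - smooth_sawtooth r x| <= 4 * (1 - r) ^+ 2 / circle_dist2 r x.
Proof.
move=> r34; have /andP[r3 r1] := r34; have r01 : 0 <= r < 1 by lra.
have half y : 0 <= y <= pi ->
    `|(pi - y) / 2 - smooth_sawtooth r y| <= 4 * (1 - r) ^+ 2 / circle_dist2 r y.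
  move=> y0p; rewrite ger0_norm; first exact: sawtooth_error_upper.
  rewrite -(sawtooth_error_at_pi r); apply: sawtooth_error_decreasing => //.
  by case/andP: y0p.
move=> /andP[x0 x2]; have [xp|px] := leP x pi; first by apply: half; rewrite x0.
have : 0 <= 2 * pi - x <= pi by lra.
move/half; rewrite smooth_sawtooth_reflect.
have -> : circle_dist2 r (2 * pi - x) = circle_dist2 r x.
  by rewrite /circle_dist2 (_ : 2 * pi - x = - x + pi *+ 2) ?cosD2pi ?cosN //; ring.
have -> : (pi - (2 * pi - x)) / 2 - - smooth_sawtooth r x =
  - ((pi - x) / 2 - smooth_sawtooth r x) by field.
by rewrite normrN.
Qed.

End Sawtooth.

(** * Sums of the smoothed functions over a family of angles *)

Section Discrepancy.
Context {R : realType}.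
Implicit Types (a b r s t h : R).

Definition cis t : R[i] := (cos t +i* sin t)%C.

Lemma cabs_cis t : cabs (cis t) = 1.
Proof. by rewrite /= cos2Dsin2 sqrtr1. Qed.

Lemma cisB t a : cis (t - a) = cis (- a) * cis t.
Proof.
rewrite /cis cosD sinD cosN sinN; apply/eqP; rewrite eq_complex /=.
by apply/andP; split; apply/eqP; ring.
Qed.

Lemma cis_resolvent s t : 0 <= s < 1 ->
  cis t / (1 - s%:C%C * cis t) =
    ((cos t - s) / circle_dist2 s t +i* (sin t / circle_dist2 s t))%C.
Proof.
move=> s01; have D0 : circle_dist2 s t != 0 by rewrite gt_eqF ?circle_dist2_gt0.
have N0 : 1 - s%:C%C * cis t != 0.
  case/andP: s01 => s0 s1.
  by rewrite subr1_unit // cabsM cabs_cis mulr1 cabs_real ger0_norm.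
apply: (mulIf N0); rewrite divfK //; apply/eqP; rewrite eq_complex /=.
have s2 := sin2cos2 t.
have E1 : cos t * circle_dist2 s t = (cos t - s) * (1 - s * cos t) + s * sin t ^+ 2.
  by rewrite s2 /circle_dist2; ring.
have E2 : sin t * circle_dist2 s t = (cos t - s) * - (s * sin t) + sin t * (1 - s * cos t).
  by rewrite /circle_dist2; ring.
apply/andP; split; apply/eqP; apply: (mulIf D0).
  by rewrite E1; field.
by rewrite E2; field.
Qed.

Section Family.
Variables (N : nat) (t : 'I_N -> R) (h : R).
Hypothesis h0 : 0 <= h.
Hypothesis resolvent : forall s, 0 <= s < 1 ->
  cabs (\sum_(j < N) cis (t j) / (1 - s%:C%C * cis (t j))) <= 2 * h / (1 - s) ^+ 2.

Lemma conjugate_kernel_sum s : 0 <= s < 1 ->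
  `|\sum_(j < N) sin (t j) / circle_dist2 s (t j)| <= 2 * h / (1 - s) ^+ 2.
Proof.
move=> s01; apply: le_trans (resolvent s01); apply: le_trans (norm_Im_le _).
by rewrite Im_sum; under [X in _ <= `|X|]eq_bigr do rewrite cis_resolvent //.
Qed.

Lemma kernel_sum s : 0 <= s < 1 ->
  \sum_(j < N) (cos (t j) - s) / circle_dist2 s (t j) <= 2 * h / (1 - s) ^+ 2.
Proof.
move=> s01; apply: le_trans (resolvent s01); apply: le_trans (Re_le_cabs _).
by rewrite Re_sum; under [X in _ <= X]eq_bigr do rewrite cis_resolvent //.
Qed.

Lemma derive_atan_radius s y : 0 <= s < 1 ->
  deriv_at s (fun r => atan (r * sin y / (1 - r * cos y))) (sin y / circle_dist2 s y).
Proof.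
move=> s01; have C0 := subr1_cos_gt0 y s01; have D0 := circle_dist2_gt0 y s01.
derive_eq; first by derive_explicit; rewrite gt_eqF.
rewrite /=; move: C0 D0 (circle_dist2E s y).
move: (circle_dist2 s y) (cos y) (sin y) => D c S C0 D0 DE.
have -> : 1 + (s * S / (1 - s * c)) ^+ 2 = D / (1 - s * c) ^+ 2.
  by rewrite DE; field; rewrite gt_eqF.
by field; rewrite !gt_eqF.
Qed.

(** The arctangent is the integral over the radius of the conjugate Poisson kernel divided by the
    radius, so integrating the resolvent bound [2 h / (1 - s)^2] from 0 to [r] suffices. *)
Lemma atan_sum_bound r : 0 <= r < 1 ->
  `|\sum_(j < N) atan (r * sin (t j) / (1 - r * cos (t j)))| <= 2 * h / (1 - r).
Proof.
move=> /andP[r0 r1].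
pose F s := \sum_(j < N) atan (s * sin (t j) / (1 - s * cos (t j))).
have F0 : F 0 = 0 by rewrite /F big1 // => j _; rewrite !mul0r atan0.
have dF s : 0 <= s < 1 -> deriv_at s F (\sum_(j < N) sin (t j) / circle_dist2 s (t j)).
  by move=> s01; apply: derive_sum => j; exact: derive_atan_radius.
have dB s : s < 1 -> deriv_at s (fun s => 2 * h / (1 - s)) (2 * h / (1 - s) ^+ 2).
  move=> s1; have s1' : 1 - s != 0 by rewrite gt_eqF // subr_gt0.
  by derive_eq; [derive_explicit | rewrite /=; field].
have B0 : 2 * h / (1 - 0) = 2 * h by rewrite subr0 divr1.
rewrite ler_norml -/(F r); apply/andP; split.
  have : 2 * h / (1 - 0) + F 0 <= 2 * h / (1 - r) + F r.
    apply: (@ler_of_derive _ (fun s => 2 * h / (1 - s) + F s) (fun s =>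
        2 * h / (1 - s) ^+ 2 + \sum_(j < N) sin (t j) / circle_dist2 s (t j))) => //.
      move=> s /andP[s0 sr]; have s1 := le_lt_trans sr r1.
      by apply: derive_add; [exact: dB | apply: dF; rewrite s0].
    move=> s /andP[s0 sr]; have s1 := le_lt_trans sr r1.
    have := @conjugate_kernel_sum s; rewrite s0 s1 ler_norml => /(_ isT)/andP[].
    by rewrite -lerBlDl sub0r.
  by rewrite B0 F0; move: h0; lra.
have : 2 * h / (1 - 0) - F 0 <= 2 * h / (1 - r) - F r.
  apply: (@ler_of_derive _ (fun s => 2 * h / (1 - s) - F s) (fun s =>
      2 * h / (1 - s) ^+ 2 - \sum_(j < N) sin (t j) / circle_dist2 s (t j))) => //.
    move=> s /andP[s0 sr]; have s1 := le_lt_trans sr r1.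
    by apply: derive_add; [exact: dB | apply: derive_opp; apply: dF; rewrite s0].
  move=> s /andP[s0 sr]; have s1 := le_lt_trans sr r1.
  have := @conjugate_kernel_sum s; rewrite s0 s1 ler_norml => /(_ isT)/andP[_].
  by rewrite subr_ge0.
by rewrite B0 F0; move: h0; lra.
Qed.

Lemma smooth_sawtooth_sum_bound r : 0 <= r < 1 ->
  `|\sum_(j < N) smooth_sawtooth r (t j)| <= 4 * h / (1 - r).
Proof.
move=> r01; have /andP[r0 r1] := r01; have d0 : 0 < 1 - r by rewrite subr_gt0.
rewrite big_split /= (le_trans (ler_normD _ _)) //.
have -> : 4 * h / (1 - r) = 2 * h / (1 - r) + 2 * h / (1 - r) by field; rewrite gt_eqF.
apply: lerD; first exact: atan_sum_bound.
have r2 : 0 < 1 + r ^+ 2 by rewrite ltr_pwDl // sqr_ge0.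
have -> : \sum_(j < N) (1 - r ^+ 2) / (1 + r ^+ 2) * (r * sin (t j) / circle_dist2 r (t j)) =
    (1 - r ^+ 2) / (1 + r ^+ 2) * r * \sum_(j < N) sin (t j) / circle_dist2 r (t j).
  by rewrite mulr_sumr; apply: eq_bigr => j _; ring.
rewrite normrM ger0_norm; last first.
  by rewrite mulr_ge0 // divr_ge0 ?ltW // subr_gt0 exprn_ilt1.
apply: (@le_trans _ _ ((1 - r) * (2 * h / (1 - r) ^+ 2))); last first.
  by rewrite le_eqVlt; apply/orP; left; apply/eqP; field; rewrite gt_eqF.
apply: ler_pM => //; last exact: conjugate_kernel_sum.
  by rewrite mulr_ge0 // divr_ge0 ?ltW // subr_gt0 exprn_ilt1.
rewrite mulrAC ler_pdivrMr // -subr_ge0.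
by rewrite (_ : _ - _ = (1 - r) ^+ 2) ?sqr_ge0 //; ring.
Qed.

(** Up to a factor the majorant is the Poisson kernel, the mean 1 plus twice the real part of
    [r e^(i t) / (1 - r e^(i t))]: the mean contributes the term in [N], the rest is bounded by
    the resolvent. *)
Lemma majorant_sum_bound r : 3 / 4 <= r < 1 ->
  \sum_(j < N) 4 * (1 - r) ^+ 2 / circle_dist2 r (t j) <=
    16 / 7 * (1 - r) * N%:R + 8 * h / (1 - r).
Proof.
move=> /andP[r34 r1]; have r0 : 0 <= r by lra.
have r01 : 0 <= r < 1 by rewrite r0.
set d := 1 - r; have d0 : 0 < d by rewrite subr_gt0.
set S := \sum_(j < N) (cos (t j) - r) / circle_dist2 r (t j).
have HS : S <= 2 * h / d ^+ 2 by exact: kernel_sum.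
have -> : \sum_(j < N) 4 * d ^+ 2 / circle_dist2 r (t j) = 4 * d / (1 + r) * (N%:R + 2 * r * S).
  have -> : (N%:R : R) = \sum_(j < N) 1 by rewrite sumr_const card_ord.
  rewrite /S mulr_sumr -big_split mulr_sumr; apply: eq_bigr => j _ /=.
  have D0 := circle_dist2_gt0 (t j) r01.
  have -> : 1 + 2 * r * ((cos (t j) - r) / circle_dist2 r (t j)) =
            (1 - r ^+ 2) / circle_dist2 r (t j).
    apply: (mulIf (lt0r_neq0 D0)); rewrite mulrDl mulrA !divfK ?gt_eqF //.
    by rewrite /circle_dist2; ring.
  rewrite /d; field; rewrite gt_eqF //=; apply/eqP; lra.
have q1 : (1 + r)^-1 <= 4 / 7.
  by rewrite -[4 / 7]invrK lef_pV2 ?posrE //; lra.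
have q0 : 0 <= (1 + r)^-1 by rewrite invr_ge0; lra.
have qr : (1 + r)^-1 * r <= 2^-1.
  by rewrite mulrC ler_pdivrMr; lra.
have -> : 4 * d / (1 + r) * (N%:R + 2 * r * S) =
  4 * d * N%:R * (1 + r)^-1 + 8 * d * ((1 + r)^-1 * r) * S by ring.
have -> : 16 / 7 * d * N%:R + 8 * h / d = 4 * d * N%:R * (4 / 7) + 8 * d * 2^-1 * (2 * h / d ^+ 2).
  by field; rewrite gt_eqF.
apply: lerD; first by apply: ler_wpM2l => //; rewrite !mulr_ge0 // ltW.
have B0 : 0 <= 2 * h / d ^+ 2 by rewrite divr_ge0 ?sqr_ge0 // mulr_ge0.
apply: (@le_trans _ _ (8 * d * ((1 + r)^-1 * r) * (2 * h / d ^+ 2))).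
  by rewrite ler_wpM2l // !mulr_ge0 // ltW.
by rewrite ler_wpM2r // ler_wpM2l // mulr_ge0 // ltW.
Qed.

End Family.

(** The difference of two sawtooth functions that jump at the ends of an arc is, up to an affine
    normalisation, the indicator of the arc.  The witnesses [u] and [v] are the representatives
    of [y - a] and [y - b] in the fundamental period. *)
Lemma indicator_sawtooth a b y : 0 <= a -> a <= b -> b <= 2 * pi -> 0 <= y < 2 * pi ->
  exists u v : R,
    [/\ 0 <= u <= 2 * pi, 0 <= v <= 2 * pi,
        cis u = cis (y - a), cis v = cis (y - b) &
        (a <= y < b)%R%:R = (b - a) / (2 * pi) + ((pi - u) / 2 - (pi - v) / 2) / pi].
Proof.
move=> a0 ab b2 /andP[y0 y2]; have p0 := pi_gt0 R.
have per (x : R) : cis (x + 2 * pi) = cis x.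
  by rewrite /cis (_ : x + 2 * pi = x + pi *+ 2) ?cosD2pi ?sinD2pi //; ring.
have [ya|ay] := ltP y a.
  exists (y - a + 2 * pi), (y - b + 2 * pi); split; rewrite ?per //; try lra.
  by rewrite /=; move: p0; generalize (@pi R) => p p0; field; rewrite gt_eqF.
have [yb|by_] := ltP y b.
  exists (y - a), (y - b + 2 * pi); split; rewrite ?per //; try lra.
  by rewrite /=; move: p0; generalize (@pi R) => p p0; field; rewrite gt_eqF.
exists (y - a), (y - b); split => //; try lra.
by rewrite /=; move: p0; generalize (@pi R) => p p0; field; rewrite gt_eqF.
Qed.

End Discrepancy.

(** * The Erdos-Turan inequality on the circle *)

Section ErdosTuran.
Context {R : realType}.
Implicit Types (a b r h y : R).

Lemma indicator_smooth_bound a b r y : 3 / 4 <= r < 1 ->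
  0 <= a -> a <= b -> b <= 2 * pi -> 0 <= y < 2 * pi ->
  `|(a <= y < b)%R%:R - (b - a) / (2 * pi) -
     (smooth_sawtooth r (y - a) - smooth_sawtooth r (y - b)) / pi| <=
  (4 * (1 - r) ^+ 2 / circle_dist2 r (y - a) +
   4 * (1 - r) ^+ 2 / circle_dist2 r (y - b)) / pi.
Proof.
move=> r34 a0 ab b2 y02; have p0 := pi_gt0 R.
have pV : 0 <= (pi : R)^-1 by rewrite invr_ge0 pi_ge0.
have [u [v [u02 v02 [cu su] [cv sv] ->]]] := indicator_sawtooth a0 ab b2 y02.
have := sawtooth_error_bound r34 u02; have := sawtooth_error_bound r34 v02.
rewrite /smooth_sawtooth /circle_dist2 cu su cv sv -!/(circle_dist2 _ _) -!/(smooth_sawtooth _ _).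
set Su := smooth_sawtooth r (y - a); set Sv := smooth_sawtooth r (y - b).
move=> Hv Hu.
have -> : (b - a) / (2 * pi) + ((pi - u) / 2 - (pi - v) / 2) / pi - (b - a) / (2 * pi) -
    (Su - Sv) / pi = (((pi - u) / 2 - Su) - ((pi - v) / 2 - Sv)) / pi by ring.
rewrite normrM (ger0_norm pV) (ler_wpM2r pV) //.
by apply: le_trans (ler_normB _ _) _; apply: lerD.
Qed.

(** The Erdos-Turan inequality for points of the circle.  The width [d] of the kernel balances
    the two sources of error, the width [d N] of the smoothing and the bound [h / d] for the
    smoothed sums. *)
Lemma erdos_turan (N : nat) (x : 'I_N -> R) h a b : (0 < N)%N -> 0 < h -> h / N%:R <= 1 / 16 ->
  (forall j, 0 <= x j < 2 * pi) ->
  (forall w, cabs w < 1 -> \sum_(j < N) ln (cabs (1 - w * cis (x j))) <= h) ->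
  0 <= a -> a <= b -> b <= 2 * pi ->
  `|(\sum_(j < N) (a <= x j < b)%R%:R) / N%:R - (b - a) / (2 * pi)| <
    16 * Num.sqrt (h / N%:R).
Proof.
move=> N0 h0 hN x02 Hx a0 ab b2; have p0 := pi_gt0 R.
have pV : 0 <= (pi : R)^-1 by rewrite invr_ge0 pi_ge0.
have n0 : 0 < N%:R :> R by rewrite ltr0n.
set d := Num.sqrt (h / N%:R).
have d0 : 0 < d by rewrite sqrtr_gt0 divr_gt0.
have d2 : d ^+ 2 = h / N%:R by rewrite sqr_sqrtr // divr_ge0 // ltW.
have d4 : d <= 1 / 4.
  rewrite -(@ler_pXn2r _ 2) ?nnegrE ?(ltW d0) // d2; lra.
have hE : h = d * d * N%:R by rewrite -expr2 d2 divfK // gt_eqF.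
pose r := 1 - d; have dE : 1 - r = d by rewrite /r; ring.
have r34 : 3 / 4 <= r < 1 by rewrite /r; lra.
have r01 : 0 <= r < 1 by rewrite /r; lra.
have res (c : R) s : 0 <= s < 1 ->
    cabs (\sum_(j < N) cis (x j - c) / (1 - s%:C%C * cis (x j - c))) <= 2 * h / (1 - s) ^+ 2.
  move=> /andP[s0 s1].
  have -> : \sum_(j < N) cis (x j - c) / (1 - s%:C%C * cis (x j - c)) =
      cis (- c) * \sum_(j < N) cis (x j) / (1 - s%:C%C * cis (- c) * cis (x j)).
    by rewrite mulr_sumr; apply: eq_bigr => j _; rewrite cisB !mulrA.
  rewrite cabsM cabs_cis mul1r.
  have ws : cabs (s%:C%C * cis (- c)) = s by rewrite cabsM cabs_cis mulr1 cabs_real ger0_norm.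
  rewrite -[in X in _ <= X]ws; apply: resolvent_sum_bound; last by rewrite ws.
    by move=> j; exact: cabs_cis.
  exact: Hx.
have sawB c := smooth_sawtooth_sum_bound (ltW h0) (res c) r01.
have majB c := majorant_sum_bound (ltW h0) (res c) r34.
set X := \sum_(j < N) _.
have -> : X / N%:R - (b - a) / (2 * pi) =
    (\sum_(j < N) ((a <= x j < b)%R%:R - (b - a) / (2 * pi))) / N%:R.
  rewrite sumrB sumr_const card_ord -[(_ / _) *+ N]mulr_natl -/X.
  by move: ((b - a) / _) => c; field; rewrite gt_eqF.
rewrite normrM [`|N%:R^-1|]ger0_norm ?invr_ge0 // ltr_pdivrMr //.
set Y := \sum_(j < N) _.
pose Sa := \sum_(j < N) smooth_sawtooth r (x j - a).
pose Sb := \sum_(j < N) smooth_sawtooth r (x j - b).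
have HY : `|Y - (Sa - Sb) / pi| <= (16 / 7 * d * N%:R + 8 * h / d) * 2 / pi.
  have -> : Y - (Sa - Sb) / pi = \sum_(j < N) ((a <= x j < b)%R%:R - (b - a) / (2 * pi) -
      (smooth_sawtooth r (x j - a) - smooth_sawtooth r (x j - b)) / pi).
    by rewrite /Sa /Sb -sumrB mulr_suml -sumrB.
  apply: le_trans (ler_norm_sum _ _ _) _.
  apply: le_trans (ler_sum _ (fun j _ => indicator_smooth_bound r34 a0 ab b2 (x02 j))) _.
  rewrite -mulr_suml big_split /= (ler_wpM2r pV) //.
  by have := majB a; have := majB b; rewrite dE; lra.
have HS : `|(Sa - Sb) / pi| <= 8 * h / d / pi.
  rewrite normrM (ger0_norm pV) (ler_wpM2r pV) //.
  apply: le_trans (ler_normB _ _) _.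
  by have := sawB a; have := sawB b; rewrite dE /Sa /Sb; lra.
have -> : Y = (Y - (Sa - Sb) / pi) + (Sa - Sb) / pi by rewrite subrK.
apply: le_lt_trans (ler_normD _ _) _; apply: le_lt_trans (lerD HY HS) _.
have hd : h / d = d * N%:R by rewrite {1}hE; field; rewrite gt_eqF.
have -> : (16 / 7 * d * N%:R + 8 * h / d) * 2 / pi + 8 * h / d / pi =
    200 / 7 / pi * (d * N%:R).
  by rewrite -[8 * h / d]mulrA hd; move: (pi^-1) => P; field.
rewrite -[16 * d * _]mulrA ltr_pM2r ?mulr_gt0 // ltr_pdivrMr //.
by have := pi_ge2 R; lra.
Qed.

End ErdosTuran.

(** * From the zeros of a polynomial to the circle *)

Section PolynomialZeros.
Context {R : realType}.
Implicit Types (z w v : R[i]) (s : seq R[i]).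

Lemma ln_prod (I : eqType) (l : seq I) (F : I -> R) :
  (forall i, i \in l -> 0 < F i) -> ln (\prod_(i <- l) F i) = \sum_(i <- l) ln (F i).
Proof.
elim: l => [|i l IH] Hl; first by rewrite !big_nil ln1.
have F0 : 0 < F i by apply: Hl; rewrite mem_head.
have Fl j : j \in l -> 0 < F j by move=> jl; apply: Hl; rewrite inE jl orbT.
rewrite !big_cons lnM ?posrE ?IH //.
by rewrite big_seq prodr_gt0.
Qed.

Lemma polar_form z : z != 0 -> z = (cabs z)%:C%C * cis (arg z).
Proof.
move=> z0; have [_ _ {1}->] := arg_spec z0.
by apply/eqP; rewrite eq_complex /= !mul0r subr0 addr0 !eqxx.
Qed.

(** Schur's comparison: pushing [z = t u] radially to the circle changes
    [|v - z|^2 / t = t + 1 / t - 2 Re (v / u)] to its minimum over [t], reached at [t = 1]. *)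
Lemma schur_radial v z : cabs v = 1 -> z != 0 ->
  cabs (v - cis (arg z)) ^+ 2 * cabs z <= cabs (v - z) ^+ 2.
Proof.
move=> v1 z0; have t0 := cabs_ge0 z; rewrite {3}(polar_form z0).
move: (cabs z) (arg z) t0 => t y t0; rewrite !sqr_cabs.
have v2 : Re v ^+ 2 + Im v ^+ 2 = 1 by rewrite -sqr_cabs v1 expr1n.
case: v {v1} v2 => p q /= v2; have := cos2Dsin2 y; move: (cos y) (sin y) => c S cS.
rewrite -subr_ge0 !mul0r subr0 addr0.
have -> : (p - t * c) ^+ 2 + (q - t * S) ^+ 2 - ((p - c) ^+ 2 + (q - S) ^+ 2) * t =
  (p ^+ 2 + q ^+ 2) * (1 - t) + (c ^+ 2 + S ^+ 2) * (t ^+ 2 - t) by ring.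
rewrite v2 cS.
have -> : 1 * (1 - t) + 1 * (t ^+ 2 - t) = (1 - t) ^+ 2 by ring.
exact: sqr_ge0.
Qed.

Variables (s : seq R[i]) (H : R).
Hypothesis s0 : forall z, z \in s -> z != 0.
Hypothesis s1 : \prod_(z <- s) cabs z = 1.
Hypothesis sH : forall v, cabs v = 1 -> \prod_(z <- s) cabs (v - z) <= H.

(** With [cabs] of the product of the zeros equal to 1, Schur's comparison shows that moving every
    zero radially to the circle does not increase the maximum on the circle. *)
Lemma unit_zeros_bound w : cabs w < 1 ->
  \sum_(z <- s) ln (cabs (1 - w * cis (arg z))) <= ln H.
Proof.
move=> w1.
have H0 : 0 <= H by apply: le_trans (sH (Normc.normc1 _)); apply: prodr_ge0 => *; exact: cabs_ge0.
pose Q : {poly R[i]} := \prod_(z <- s) (1 - (cis (arg z))%:P * 'X).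
have QE v : Q.[v] = \prod_(z <- s) (1 - v * cis (arg z)).
  by rewrite horner_prod; apply: eq_bigr => z _; rewrite !hornerE mulrC.
have Qcirc v : cabs v = 1 -> cabs Q.[v] <= H.
  move=> v1; have vJ1 : cabs (v^*)%C = 1 by rewrite cabs_conj.
  have vJ : v * (v^*)%C = 1 by rewrite mulz_conj v1 expr1n.
  rewrite QE cabs_prod -(@ler_pXn2r _ 2) ?nnegrE ?prodr_ge0 // => [|*]; last exact: cabs_ge0.
  apply: le_trans (_ : (\prod_(z <- s) cabs ((v^*)%C - z)) ^+ 2 <= _); last first.
    rewrite lerXn2r ?nnegrE ?sH ?prodr_ge0 // => *; exact: cabs_ge0.
  rewrite -!prodrXl -[leLHS]mulr1 -[X in _ * X <= _]s1 -big_split /=.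
  rewrite big_seq [leRHS]big_seq.
  apply: ler_prod => z zs; rewrite mulr_ge0 ?sqr_ge0 ?cabs_ge0 //=.
  apply: le_trans (schur_radial vJ1 (s0 zs)).
  have -> : 1 - v * cis (arg z) = v * ((v^*)%C - cis (arg z)) by rewrite mulrBr vJ.
  by rewrite cabsM v1 mul1r.
have F0 z : z \in s -> 0 < cabs (1 - w * cis (arg z)).
  by move=> _; rewrite lt_neqAle cabs_ge0 eq_sym cabs_eq0 subr1_unit // cabsM cabs_cis mulr1.
rewrite -ln_prod //; have := polynomial_max_principle Qcirc w1; rewrite QE cabs_prod => QH.
have P0 : 0 < \prod_(z <- s) cabs (1 - w * cis (arg z)) by rewrite big_seq prodr_gt0.
by rewrite ler_ln ?posrE // (lt_le_trans P0).
Qed.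

Lemma zeros_sector_discrepancy (a b : R) : (0 < size s)%N -> 1 < H ->
  ln H / (size s)%:R <= 1 / 16 -> 0 <= a -> a <= b -> b <= 2 * pi ->
  `|(count (mem (sector a b)) s)%:R / (size s)%:R - (b - a) / (2 * pi)| <
    16 * Num.sqrt (ln H / (size s)%:R).
Proof.
move=> N0 H1 HN a0 ab b2.
have -> : (count (mem (sector a b)) s)%:R =
    \sum_(j < size s) (a <= arg (s`_j) < b)%R%:R :> R.
  rewrite -sum1_count natr_sum big_mkcond (big_nth 0) big_mkord /=.
  apply: eq_bigr => j _; have -> : (s`_j \in sector a b) = (a <= arg (s`_j) < b).
    by apply/idP/idP; rewrite in_setE.
  by case: ifP.
apply: erdos_turan => //; first exact: ln_gt0.
  by move=> j; have [-> -> _] := arg_spec (s0 (mem_nth 0 (ltn_ord j))).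
move=> w w1; have := unit_zeros_bound w1; rewrite (big_nth 0) big_mkord; exact.
Qed.

(** Mahler's inequality.  Replacing each factor [X - z] with [|z| < 1] by [1 - conj(z) X]
    leaves absolute values on the circle unchanged and makes the value at 0 the Mahler measure. *)
Lemma mahler_measure_bound : \prod_(z <- s) Num.max 1 (cabs z) <= H.
Proof.
pose g z : {poly R[i]} := if 1 <= cabs z then 'X - z%:P else 1 - ((z^*)%C)%:P * 'X.
pose Q := \prod_(z <- s) g z.
have Qcirc v : cabs v = 1 -> cabs Q.[v] <= H.
  move=> v1; apply: le_trans (sH v1); rewrite horner_prod cabs_prod.
  rewrite le_eqVlt; apply/orP; left; apply/eqP; apply: eq_bigr => z _.
  rewrite /g; case: ifP => _; rewrite !hornerE //.
  have -> : 1 - (z^*)%C * v = v * ((v - z)^*)%C.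
    by rewrite rmorphB mulrBr mulz_conj v1 expr1n mulrC.
  by rewrite cabsM v1 mul1r cabs_conj.
have := polynomial_max_principle Qcirc (w := 0); rewrite Normc.normc0 => /(_ ltr01).
rewrite horner_prod cabs_prod; congr (_ <= _); apply: eq_bigr => z _.
rewrite /g; case: leP => z1; rewrite !hornerE.
  by rewrite cabsN.
by rewrite subr0 Normc.normc1.
Qed.

(** Since the logarithms add up to 0, their absolute values add up to twice the logarithm of the
    Mahler measure. *)
Lemma sum_abs_ln_bound : \sum_(z <- s) `|ln (cabs z)| <= 2 * ln H.
Proof.
have c0 z : z \in s -> 0 < cabs z.
  by move=> zs; rewrite lt_neqAle cabs_ge0 eq_sym cabs_eq0 s0.
have m0 z : 0 < Num.max 1 (cabs z) by rewrite lt_max ltr01.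
have E : \sum_(z <- s) `|ln (cabs z)| =
    2 * \sum_(z <- s) ln (Num.max 1 (cabs z)) - \sum_(z <- s) ln (cabs z).
  rewrite mulr_sumr -sumrB big_seq [RHS]big_seq; apply: eq_bigr => z zs.
  case: (leP 1 (cabs z)) => z1.
    by rewrite ger0_norm ?ln_ge0 //; ring.
  by rewrite ln1 mulr0 sub0r ler0_norm // ln_le0 // ltW.
rewrite E -ln_prod // -[X in _ - X]ln_prod // s1 ln1 subr0 ler_wpM2l //.
have P0 : 0 < \prod_(z <- s) Num.max 1 (cabs z) by rewrite prodr_gt0.
by rewrite ler_ln ?posrE ?mahler_measure_bound // (lt_le_trans P0 mahler_measure_bound).
Qed.

Lemma annulusP (rho : R) z : (z \in annulus rho) = (1 - rho <= cabs z <= 1 / (1 - rho)).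
Proof. by apply/idP/idP; rewrite in_setE /annulus /= -cabsE !lecR. Qed.

(** Outside the annulus [|ln |z||] exceeds [- ln (1 - rho)], hence [rho]; the total of
    [|ln |z||] over all zeros is at most [2 ln H]. *)
Lemma zeros_outside_annulus (rho : R) : 0 < rho < 1 -> 1 < H ->
  rho * (count (predC (mem (annulus rho))) s)%:R < 2 * ln H.
Proof.
move=> /andP[r0 r1] H1; have lnH := ln_gt0 H1.
have q0 : 0 < 1 - rho by rewrite subr_gt0.
have lnq : ln (1 - rho) <= - rho by apply: le_ln1Dx; rewrite ltrN2.
have far z : z \in s -> z \notin annulus rho -> rho < `|ln (cabs z)|.
  move=> zs; have z0 : 0 < cabs z by rewrite lt_neqAle cabs_ge0 eq_sym cabs_eq0 s0.
  rewrite annulusP negb_and -!ltNge => /orP[zq|qz].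
    have : ln (cabs z) < ln (1 - rho) by rewrite ltr_ln ?posrE.
    by move=> zl; rewrite ltr0_norm; lra.
  have : ln (1 / (1 - rho)) < ln (cabs z) by rewrite ltr_ln ?posrE ?divr_gt0.
  rewrite div1r lnV ?posrE // => zl.
  by rewrite gtr0_norm; lra.
have [no|yes] := boolP (has (predC (mem (annulus rho))) s); last first.
  move: yes; rewrite has_count -leqNgt leqn0 => /eqP ->.
  by rewrite mulr0 mulr_gt0.
apply: lt_le_trans sum_abs_ln_bound.
rewrite -sum1_count natr_sum mulr_sumr.
apply: (@lt_le_trans _ _ (\sum_(z <- s | z \notin annulus rho) `|ln (cabs z)|)).
  rewrite big_seq_cond [ltRHS]big_seq_cond; apply: ltr_sum.
    have /hasP[z zs zo] := no; apply/hasP; exists z => //.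
    by rewrite zs.
  by move=> z /andP[zs zo]; rewrite mulr1; exact: far.
rewrite [leRHS](bigID (fun z => z \notin annulus rho)) /= lerDl.
by apply: sumr_ge0.
Qed.

End PolynomialZeros.

(** * Degrees and sizes of the Stern polynomials *)

Section SternShape.
Context {K : idomainType}.
Local Notation stern := (stern K).

Lemma stern_ind (P : nat -> Prop) : P 1%N ->
  (forall m, (0 < m)%N -> P m -> P (2 * m)%N) ->
  (forall m, (0 < m)%N -> P m -> P m.+1 -> P (2 * m + 1)%N) ->
  forall n, (0 < n)%N -> P n.
Proof.
move=> P1 Pe Po n; elim/ltn_ind: n => n IH n0.
have := odd_double_half n; case: (odd n) => /= nE.
  have [n1|n1] := eqVneq n 1%N; first by rewrite n1.
  by rewrite (_ : n = 2 * n./2 + 1)%N; [apply: Po; try apply: IH; lia | lia].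
by rewrite (_ : n = 2 * n./2)%N; [apply: Pe; try apply: IH; lia | lia].
Qed.

Lemma size_comp_X2 (p : {poly K}) : p != 0 -> size (p \Po 'X^2) = (2 * size p).-1.
Proof.
move=> p0; have sp : (0 < size p)%N by rewrite size_poly_gt0.
rewrite -[LHS]prednK; last by rewrite size_poly_gt0 comp_poly_eq0 ?size_polyXn.
rewrite size_comp_poly size_polyXn /=.
by move: sp; case: (size p) => // q _; rewrite mulnC mulnS.
Qed.

Lemma monic_comp_X2 (p : {poly K}) : p \is monic -> p \Po 'X^2 \is monic.
Proof.
move=> /monicP p1; apply/monicP.
by rewrite lead_coef_comp ?size_polyXn // p1 lead_coefXn expr1n mulr1.
Qed.

(** The two summands of [stern (2 * m + 1)] never have equal degree: the one whose index is
    odd dominates.  Hence all Stern polynomials are monic, and their degree is governed by the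
    odd part of the index. *)
Lemma stern_shape n : (0 < n)%N ->
  [/\ stern n \is monic, (stern n).[0] = 1 &
      if odd n then (2 * size (stern n) = n.+1)%N else (2 * size (stern n) <= n)%N].
Proof.
elim/stern_ind => [|m m0 [mon v0 sz]|m m0 [mon v0 sz] [mon' v0' sz']].
- by rewrite stern1 monic1 hornerC size_poly1.
- rewrite stern_even // monic_comp_X2 // horner_comp !hornerE expr0n /= v0.
  have p0 := monic_neq0 mon; rewrite size_comp_X2 // oddM /=.
  have s0 : (0 < size (stern m))%N by rewrite size_poly_gt0.
  by split => //; move: s0 sz; move: (size (stern m)) => d; case: (odd m); lia.
rewrite stern_odd //; set p := stern m \Po 'X^2; set q := stern m.+1 \Po 'X^2.
have p1 : 'X * p \is monic by rewrite monicMl ?monicX // monic_comp_X2.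
have q1 : q \is monic by rewrite monic_comp_X2.
have pn := monic_neq0 mon; have qn := monic_neq0 mon'.
have sp : size ('X * p) = (2 * size (stern m))%N.
  have s0 : (0 < size (stern m))%N by rewrite size_poly_gt0.
  rewrite mulrC size_mulX ?(monic_neq0 (monic_comp_X2 mon)) // size_comp_X2 //.
  by move: s0; move: (size (stern m)) => d; lia.
have sq : size q = (2 * size (stern m.+1)).-1 by rewrite size_comp_X2.
have s0 : (0 < size (stern m.+1))%N by rewrite size_poly_gt0.
rewrite oddD oddM /= hornerD hornerM hornerX mul0r add0r horner_comp !hornerE expr0n /=.
move: sz sz' s0 sp sq; rewrite /=; move: (size (stern m)) (size (stern m.+1)) => d d'.
case: (boolP (odd m)) => om /= sz sz' s0 sp sq.
  have lt : (size q < size ('X * p)%R)%N by rewrite sp sq; lia.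
  rewrite size_polyDl //; split => //; last by rewrite sp; lia.
  by apply/monicP; rewrite lead_coefDl // (monicP p1).
have lt : (size ('X * p)%R < size q)%N by rewrite sp sq; lia.
rewrite addrC size_polyDl //; split => //; last by rewrite sq; lia.
by apply/monicP; rewrite lead_coefDl // (monicP q1).
Qed.

Lemma stern_degree_odd n : odd n -> (2 * (size (stern n)).-1).+1 = n.
Proof.
move=> on; have n0 : (0 < n)%N by case: n on.
by have [_ _] := stern_shape n0; rewrite on; move: (size (stern n)) => d; lia.
Qed.

Lemma stern_degree_lower n : (0 < n)%N -> ~ (exists k, n = (2 ^ k)%N) ->
  (n <= 3 * (size (stern n)).-1)%N.
Proof.
elim/stern_ind => [np|m m0 IH np|m m0 _ _ _].
- by case: np; exists 0%N.
- have /IH : ~ (exists k, m = (2 ^ k)%N).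
    by move=> [k mk]; apply: np; exists k.+1; rewrite expnS mk.
  have [mon _ _] := stern_shape m0; rewrite stern_even // size_comp_X2 ?monic_neq0 //.
  by move: (size (stern m)) => d; lia.
have := @stern_degree_odd (2 * m + 1); rewrite oddD oddM /= => /(_ isT).
by move: (size (stern (2 * m + 1))) => d; lia.
Qed.

End SternShape.

Section SternBound.
Context {R : realType}.
Local Notation stern := (stern R[i]).

(** Twice a bound for the Stern polynomials on the unit circle.  From index 7 on the bound
    [n / 2] reproduces itself under the recursion; it fails at 3 and 5, so the values of the
    Stern sequence itself start the induction. *)
Definition stern_bound2 (n : nat) : nat :=
  if (n < 7)%N then nth 0%N [:: 0; 2; 2; 4; 2; 6; 4]%N n else n.

Lemma stern_circle_bound n v : (0 < n)%N -> cabs v = 1 ->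
  2 * cabs (stern n).[v] <= (stern_bound2 n)%:R.
Proof.
move=> n0; elim/stern_ind: n0 v => [|m m0 IH|m m0 IH IH'] v v1.
- by rewrite stern1 hornerC Normc.normc1 mulr1.
- rewrite stern_even // horner_comp hornerXn (le_trans (IH _ _)) ?cabsX ?v1 ?expr1n //.
  rewrite ler_nat /stern_bound2.
  by case: ltnP => m7; [case: m m7 m0 {IH} => [|[|[|[|[|[|[]]]]]]] | case: ltnP; lia].
rewrite stern_odd // hornerD hornerM hornerX !horner_comp !hornerXn.
have v2 : cabs (v ^+ 2) = 1 by rewrite cabsX v1 expr1n.
apply: (@le_trans _ _ (2 * (cabs (stern m).[v ^+ 2] + cabs (stern m.+1).[v ^+ 2]))).
  by rewrite ler_wpM2l // (le_trans (cabsD _ _)) // cabsM v1 mul1r.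
rewrite mulrDr (le_trans (lerD (IH _ v2) (IH' _ v2))) // -natrD ler_nat /stern_bound2.
case: (ltnP m 7) => m7.
  by case: m m7 m0 {IH IH'} => [|[|[|[|[|[|[]]]]]]].
have -> : (m.+1 < 7)%N = false by lia.
have -> : (2 * m + 1 < 7)%N = false by lia.
by lia.
Qed.

End SternBound.

(** * The zeros of the Stern polynomials *)

Section SternZeros.
Context {R : realType}.
Implicit Types (X rho a b : R).

Lemma stern_zeros n : (0 < n)%N -> exists s : seq R[i],
  [/\ stern R[i] n = \prod_(z <- s) ('X - z%:P), size s = stern_degree R n,
      (forall z, z \in s -> z != 0) & \prod_(z <- s) cabs z = 1].
Proof.
move=> n0; have [mon v0 _] := @stern_shape R[i] n n0.
have [s sE] := closed_field_poly_normal (stern R[i] n).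
rewrite (monicP mon) scale1r in sE; exists s.
have P1 : \prod_(z <- s) cabs z = 1.
  have : cabs (stern R[i] n).[0] = 1 by rewrite v0 Normc.normc1.
  rewrite sE horner_prod cabs_prod => e1; rewrite -[RHS]e1; apply: eq_bigr => z _.
  by rewrite !hornerE cabsN.
split => //; first by rewrite /stern_degree sE size_prod_XsubC.
move=> z zs; apply/eqP => z0; have /eqP := P1; apply/negP.
by rewrite (big_rem z) //= z0 Normc.normc0 mul0r eq_sym oner_neq0.
Qed.

Lemma zeros_count n (s : seq R[i]) (A : set R[i]) :
  stern R[i] n = \prod_(z <- s) ('X - z%:P) -> num_zeros (stern R[i] n) A = count (mem A) s.
Proof. by move=> ->; rewrite -[X in num_zeros X]scale1r num_zerosE ?oner_neq0. Qed.

Lemma ratio_sub_bounded (k m : nat) a b : (k <= m)%N -> 0 <= a -> a <= b -> b <= 2 * pi ->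
  -1 <= k%:R / m%:R - (b - a) / (2 * pi) <= 1.
Proof.
move=> km a0 ab b2; have p0 : 0 < 2 * pi :> R by rewrite mulr_gt0 // pi_gt0.
have q0 : 0 <= k%:R / m%:R :> R by rewrite divr_ge0.
have q1 : k%:R / m%:R <= 1 :> R.
  have [->|m0] := posnP m; first by rewrite invr0 mulr0.
  by rewrite ler_pdivrMr ?ltr0n // mul1r ler_nat.
have t0 : 0 <= (b - a) / (2 * pi) by rewrite divr_ge0 ?subr_ge0 // ltW.
have t1 : (b - a) / (2 * pi) <= 1 by rewrite ler_pdivrMr // mul1r; lra.
by move: q0 q1 t0 t1; move: (_ / _) ((b - a) / _) => u v; lra.
Qed.

(** The sector bound exceeds 1 unless [X] is small, and then the step of the smoothing kernel
    is small enough for [zeros_sector_discrepancy]. *)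
Lemma sector_conclusion (s : seq R[i]) H X a b : (0 < size s)%N ->
  (forall z, z \in s -> z != 0) -> \prod_(z <- s) cabs z = 1 ->
  (forall v, cabs v = 1 -> \prod_(z <- s) cabs (v - z) <= H) -> 1 < H ->
  (ln H / (size s)%:R <= X) || (1 / 16 < X) -> 0 <= a -> a <= b -> b <= 2 * pi ->
  - (16 * Num.sqrt X) < (count (mem (sector a b)) s)%:R / (size s)%:R - (b - a) / (2 * pi)
    < 16 * Num.sqrt X.
Proof.
move=> N0 s0 s1 sH H1 HX a0 ab b2.
rewrite -ltr_norml; have [Xbig|Xsmall] := ltP (1 / 16) X.
  have : `|(count (mem (sector a b)) s)%:R / (size s)%:R - (b - a) / (2 * pi)| <= 1.
    by rewrite ler_norml ratio_sub_bounded // count_size.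
  move/le_lt_trans; apply.
  have : Num.sqrt ((1 / 16) ^+ 2) < Num.sqrt X by rewrite ltr_sqrt; lra.
  by rewrite sqrtr_sqr ger0_norm //; lra.
have {}HX : ln H / (size s)%:R <= X by move: HX; rewrite ltNge Xsmall orbF.
apply: lt_le_trans (zeros_sector_discrepancy s0 s1 sH N0 H1 _ a0 ab b2) _.
  exact: le_trans HX Xsmall.
by rewrite ler_wpM2l // ler_wsqrtr.
Qed.

Lemma annulus_conclusion (s : seq R[i]) H X rho : (0 < size s)%N ->
  (forall z, z \in s -> z != 0) -> \prod_(z <- s) cabs z = 1 ->
  (forall v, cabs v = 1 -> \prod_(z <- s) cabs (v - z) <= H) -> 1 < H ->
  ln H / (size s)%:R <= X -> 0 < rho < 1 ->
  (0 : R) <= 1 - (count (mem (annulus rho)) s)%:R / (size s)%:R < 2 / rho * X.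
Proof.
move=> N0 s0 s1 sH H1 HX r01; have /andP[r0 r1] := r01.
have n0 : 0 < (size s)%:R :> R by rewrite ltr0n.
have := zeros_outside_annulus s0 s1 sH r01 H1.
have -> : 1 - (count (mem (annulus rho)) s)%:R / (size s)%:R =
    (count (predC (mem (annulus rho))) s)%:R / (size s)%:R :> R.
  have sE : (size s)%:R = (count (mem (annulus rho)) s)%:R +
      (count (predC (mem (annulus rho))) s)%:R :> R by rewrite -natrD count_predC.
  by rewrite sE in n0 *; field; rewrite gt_eqF.
move=> out; rewrite divr_ge0 //=; apply: (@lt_le_trans _ _ (2 / rho * (ln H / (size s)%:R))).
  by rewrite mulrA ltr_pM2r ?invr_gt0 // mulrAC ltr_pdivlMr // mulrC.
by rewrite ler_wpM2l // divr_ge0 // ltW.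
Qed.

Lemma ln_half_cube (n : nat) : (0 < n)%N -> 3 * ln n%:R - ln 8 = 3 * ln (n%:R / 2) :> R.
Proof.
move=> n0; rewrite ln_div ?posrE ?ltr0n // mulrBr; congr (_ - _).
by rewrite (_ : 8 = 2 ^+ 3) ?lnXn ?mulr_natl //; ring.
Qed.

Lemma small_not_pow2 n : (0 < n)%N -> ~ (exists k, n = (2 ^ k)%N) ->
  [\/ n = 3, n = 5 | (6 <= n)%N].
Proof.
move=> n0 np; case: n n0 np => [//|[|[|[|[|[|n]]]]]] _ np; try by case: np.
- by case: np; exists 0%N.
- by case: np; exists 1%N.
- by constructor 1.
- by case: np; exists 2%N.
- by constructor 2.
- by constructor 3.
Qed.

End SternZeros.

Unset Implicit Arguments.

Theorem proposition2p1 (R : realType) (rho theta1 theta2 : R) (n : nat) :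
  0 < rho < 1 -> 0 <= theta1 -> theta1 < theta2 -> theta2 <= 2 * pi ->
  (0 < n)%N -> ~ (exists k : nat, n = (2 ^ k)%N) ->
  (- (16 * Num.sqrt ((3 * ln n%:R - ln 8) / n%:R))
     < (zeros_in_sector n theta1 theta2)%:R / (stern_degree R n)%:R
         - (theta2 - theta1) / (2 * pi)
     < 16 * Num.sqrt ((3 * ln n%:R - ln 8) / n%:R))
  /\
  ((0 : R) <= 1 - (zeros_in_annulus n rho)%:R / (stern_degree R n)%:R
     < (2 / rho) * ((3 * ln n%:R - ln 8) / n%:R)).
Proof.
move=> r01 t1 t12 t2 n0 np.
have [s [sE sz s0 s1]] := @stern_zeros R n n0.
have deg3 : (n <= 3 * size s)%N by rewrite sz; exact: (@stern_degree_lower R[i]).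
have N0 : (0 < size s)%N by lia.
rewrite /zeros_in_sector /zeros_in_annulus !(zeros_count _ sE) -sz ln_half_cube //.
set X := 3 * ln (n%:R / 2) / n%:R.
have sH v : cabs v = 1 -> \prod_(z <- s) cabs (v - z) <= (stern_bound2 n)%:R / 2.
  move=> v1; rewrite ler_pdivlMr // mulrC.
  apply: le_trans (stern_circle_bound n0 v1).
  rewrite sE horner_prod cabs_prod ler_wpM2l //.
  by apply: ler_prod => z _; rewrite cabs_ge0 /= !hornerE.
have tle := ltW t12.
have [n3|n5|n6] := small_not_pow2 n0 np.
- (* the single zero has absolute value 1 since the product of the zeros has *)
  have s_size : size s = 1%N.
    have := @stern_degree_odd R[i] 3 isT; rewrite sz /stern_degree n3.
    by move: (size (stern R[i] 3)) => d; lia.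
  have X16 : 1 / 16 < X.
    rewrite /X n3 mulrAC divff // mul1r.
    have : ln (1 + - (1 / 3)) <= - (1 / 3) :> R by apply: le_ln1Dx; lra.
    rewrite (_ : 1 + - (1 / 3) = (3 / 2)^-1 :> R); last by field.
    by rewrite lnV ?posrE //; lra.
  split.
    apply: (sector_conclusion N0 s0 s1 sH) => //; last by rewrite X16 orbT.
    by rewrite n3 /stern_bound2 /=; lra.
  have /andP[r0 r1] := r01.
  case: s s_size s1 {sE sz s0 sH deg3 N0} => [//|z [|//]] _; rewrite big_seq1 => z1.
  have -> : count (mem (annulus rho)) [:: z] = 1%N.
    rewrite /= annulusP z1 ler_pdivlMr ?subr_gt0 // mul1r.
    by rewrite gerBl (ltW r0).
  rewrite divff // subrr lexx /=; apply: mulr_gt0; first by rewrite divr_gt0.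
  by move: X16; lra.
- (* 3 ^ 5 = 243 is just below (5 / 2) ^ 6 = 244.14 *)
  have s_size : size s = 2%N.
    have := @stern_degree_odd R[i] 5 isT; rewrite sz /stern_degree n5.
    by move: (size (stern R[i] 5)) => d; lia.
  have bE : (stern_bound2 n)%:R / 2 = 3 :> R by rewrite n5 /stern_bound2 /=; lra.
  have X5 : ln 3 / (size s)%:R <= X.
    have : ln (3 ^+ 5) <= ln ((5 / 2) ^+ 6) :> R.
      by rewrite ler_ln ?posrE ?exprn_gt0 ?divr_gt0 //; lra.
    rewrite !lnXn ?divr_gt0 // -[ln 3 *+ 5]mulr_natl -[ln _ *+ 6]mulr_natl s_size /X n5.
    by lra.
  have H1 : (1 : R) < 3 by lra.
  split; last by apply: (annulus_conclusion (H := 3)) => // v v1; rewrite -bE sH.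
  by apply: (sector_conclusion (H := 3)) => // [v v1|]; rewrite ?X5 // -bE sH.
- have nR : (6 : R) <= n%:R by rewrite ler_nat.
  have H1 : (1 : R) < n%:R / 2 by lra.
  have sH' v : cabs v = 1 -> \prod_(z <- s) cabs (v - z) <= n%:R / 2.
    move=> v1; apply: le_trans (sH v v1) _; rewrite ler_wpM2r //.
    rewrite ler_nat /stern_bound2; case: ltnP => // n7.
    by rewrite (_ : n = 6)%N //; lia.
  have XH : ln (n%:R / 2) / (size s)%:R <= X.
    have l0 := ln_gt0 H1; rewrite /X ler_pdivrMr ?ltr0n // mulrAC ler_pdivlMr ?ltr0n //.
    rewrite [3 * _]mulrC -mulrA ler_wpM2l ?(ltW l0) //.
    by rewrite -natrM ler_nat.
  split; last exact: annulus_conclusion sH' H1 XH r01.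
  by apply: (sector_conclusion N0 s0 s1 sH') => //; rewrite XH.
Qed.
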